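(* Let $q\in(0,1)$, $G\in\{B,C,D\}$, $\mathbf y\in\mathfrak Y$, and let $\{\mu(N)\in\mathbb{GT}^+_N\}_{N\ge1}$ be a sequence of random nonnegative signatures such that each $\mu(N)$ is $M^{\mathbf y}_N$-distributed. Then, for any $k\in\mathbb N$, the probability of the event $$\mu(L)_{L+1-k}=y_k$$ tends to $1$ as $L\to\infty$.
   Context: $\epsilon=\frac12,1,0$ for $G=B,C,D$. $\mathbb{GT}^+_N$ is the set of $\lambda=(\lambda_1\ge\cdots\ge\lambda_N\ge0)\in\mathbb Z^N$. With $V^s(z_1,\ldots,z_N)=\prod_{i<j}(z_i+z_i^{-1}-z_j-z_j^{-1})$, $\chi^G_\lambda(z_1,\ldots,z_N)$ is the Laurent polynomial equal to $1/V^s(z_1,\ldots,z_N)$ times $\det\big[\frac{z_j^{\lambda_i+N-i+1/2}-z_j^{-(\lambda_i+N-i+1/2)}}{z_j^{1/2}-z_j^{-1/2}}\big]$ for $G=B$, $\det\big[\frac{z_j^{\lambda_i+N-i+1}-z_j^{-(\lambda_i+N-i+1)}}{z_j-z_j^{-1}}\big]$ for $G=C$, $\det\big[z_j^{\lambda_i+N-i}+z_j^{-(\lambda_i+N-i)}\big]$ for $G=D$ (all $1\le i,j\le N$). Markov kernels. For $N\ge1$ and $\lambda\in\mathbb{GT}^+_{N+1}$, the numbers $\Lambda^{N+1}_N(\lambda,\mu)$, $\mu\in\mathbb{GT}^+_N$, are the unique coefficients in $$\frac{\chi^G_\lambda(x_1,\ldots,x_N,q^{N+\epsilon})}{\chi^G_\lambda(q^\epsilon,q^{1+\epsilon},\ldots,q^{N+\epsilon})}=\sum_{\mu\in\mathbb{GT}^+_N}\Lambda^{N+1}_N(\lambda,\mu)\frac{\chi^G_\mu(x_1,\ldots,x_N)}{\chi^G_\mu(q^\epsilon,q^{1+\epsilon},\ldots,q^{N-1+\epsilon})}.$$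 These matrices are stochastic. For $N>k$ let $\Lambda^N_k=\Lambda^N_{N-1}\cdots\Lambda^{k+1}_k$. $\mathfrak Y$ is the set of integer sequences $\mathbf y=(0\le y_1\le y_2\le\cdots)$; $\{\lambda(N)\in\mathbb{GT}^+_N\}$ stabilizes to $\mathbf y$ if $\lim_{N\to\infty}\lambda(N)_{N+1-i}=y_i$ for all $i\ge1$. $M^{\mathbf y}_k$ is the probability measure on $\mathbb{GT}^+_k$ given by $M^{\mathbf y}_k(\mu)=\lim_{N\to\infty}\Lambda^N_k(\lambda(N),\mu)$ for any sequence $\{\lambda(N)\}$ stabilizing to $\mathbf y$ (the limit exists, defines a probability measure, and is independent of the sequence). *)

(* Defs.v *)
From HB Require Import structures.
From mathcomp Require Import all_boot all_order all_algebra.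
From mathcomp Require Import all_classical all_reals all_analysis.
Set Implicit Arguments.
Unset Strict Implicit.
Unset Printing Implicit Defensive.
Import Order.TTheory GRing.Theory Num.Theory.
Import numFieldNormedType.Exports.
Local Open Scope classical_set_scope.
Local Open Scope ring_scope.

Inductive series_type := typeB | typeC | typeD.

(* Nonnegative signatures: lambda_1 >= ... >= lambda_N >= 0. *)
Definition GT (N : nat) : Type := {l : N.-tuple nat | sorted geq l}.

Lemma GT0_subproof N : sorted geq (nseq_tuple N 0%N).
Proof. by case: N => //= N; elim: N => //= N ->. Qed.

HB.instance Definition _ N := Choice.on (GT N).
HB.instance Definition _ N :=
  isPointed.Build (GT N) (exist _ (nseq_tuple N 0%N) (GT0_subproof N)).
HB.instance Definition _ N := @isMeasurable.Build default_measure_display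
  (GT N) discrete_measurable discrete_measurable0
  discrete_measurableC discrete_measurableU.

(* [part l i] is lambda_i with the 1-based indexing of the mathematics;
   it is a junk value unless 1 <= i <= N. *)
Definition part (N : nat) (l : GT N) (i : nat) : nat := nth 0%N (val l) i.-1.

Section Characters.
Variable R : realType.

Definition eps (G : series_type) : R :=
  match G with typeB => 2^-1 | typeC => 1 | typeD => 0 end.

(* V^s *)
Definition Vs (N : nat) (z : 'I_N -> R) : R :=
  \prod_(i < N) \prod_(j < N | (i < j)%N)
    (z i + (z i)^-1 - z j - (z j)^-1).

(* Determinant entry for l = lambda_i + N - i.  For typeB, z is positive and
   half-integer powers are real powers. *)
Definition char_entry (G : series_type) (l : nat) (z : R) : R :=
  match G with
  | typeB => (z `^ (l%:R + 2^-1) - z `^ (- (l%:R + 2^-1)))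
             / (z `^ 2^-1 - z `^ (- 2^-1))
  | typeC => (z ^+ l.+1 - z ^- l.+1) / (z - z^-1)
  | typeD => z ^+ l + z ^- l
  end.

(* The value of the Laurent polynomial chi^G_lambda at a point with positive
   coordinates where no denominator vanishes; it is used only at such points.
   The ordinal i : 'I_N stands for the 1-based index i.+1. *)
Definition chi (G : series_type) (N : nat) (l : GT N) (z : 'I_N -> R) : R :=
  (Vs z)^-1 *
  \det (\matrix_(i < N, j < N) char_entry G (part l i.+1 + (N - i.+1)) (z j)).

(* No denominator in [chi] vanishes at these points, whatever G is.  For a fixed
   positive a <> 1, the x such that (x_1, ..., x_N, a) is generic form a
   nonempty open set, so two Laurent polynomials that agree there are equal. *)
Definition generic (N : nat) (z : 'I_N -> R) : Prop :=
  (forall i, 0 < z i /\ z i != 1) /\ Vs z != 0.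

(* (x_1, ..., x_N, a) *)
Definition snoc (N : nat) (x : 'I_N -> R) (a : R) : 'I_N.+1 -> R :=
  fun i => oapp x a (unlift ord_max i).

(* (q^eps, q^(1+eps), ..., q^(N-1+eps)); here Vs is nonzero, and the only
   coordinate that can be 1 is the first one for typeD. *)
Definition qpoint (q : R) (G : series_type) (N : nat) : 'I_N -> R :=
  fun i => q `^ (i%:R + eps G).

(* The expansion is an identity of Laurent polynomials in x_1, ..., x_N, so
   the sum is finite. *)
Definition is_branching (q : R) (G : series_type) (N : nat) (l : GT N.+1)
    (c : GT N -> R) : Prop :=
  finite_set [set m | c m != 0] /\
  forall x : 'I_N -> R, generic (snoc x (q `^ (N%:R + eps G))) ->
    chi G l (snoc x (q `^ (N%:R + eps G))) / chi G l (@qpoint q G N.+1) =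
    \sum_(m \in [set: GT N]) c m * (chi G m x / chi G m (@qpoint q G N)).

(* Lambda^{N+1}_N(lambda, mu) *)
Definition Lambda1 (q : R) (G : series_type) (N : nat) (l : GT N.+1) :
    GT N -> R :=
  xget (fun=> 0) [set c | is_branching q G l c].

(* Lambda^{d+k}_k = Lambda^{d+k}_{d+k-1} ... Lambda^{k+1}_k; the sums are
   finite since rows of Lambda1 have finite support. *)
Fixpoint Lambda (q : R) (G : series_type) (k d : nat) :
    GT (d + k) -> GT k -> R :=
  match d return GT (d + k) -> GT k -> R with
  | 0 => fun l m => (l == m)%:R
  | d'.+1 => fun l m =>
      \sum_(n \in [set: GT (d' + k)]) @Lambda1 q G (d' + k) l n * @Lambda q G k d' n m
  end.

(* Elements y_1 <= y_2 <= ... of the set Y; the value y 0 is irrelevant. *)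
Definition in_Y (y : nat -> nat) : Prop :=
  forall i j, (0 < i)%N -> (i <= j)%N -> (y i <= y j)%N.

(* Limits are in the discrete space nat. *)
Definition stabilizes (l : forall N, GT N) (y : nat -> nat) : Prop :=
  forall i, (0 < i)%N -> part (l N) (N.+1 - i) @[N --> \oo] --> y i.

(* M is the boundary measure M^y_k. *)
Definition is_boundary_measure (q : R) (G : series_type) (y : nat -> nat)
    (k : nat) (M : probability (GT k) R) : Prop :=
  forall l : forall N, GT N, stabilizes l y ->
    forall m : GT k,
      (@Lambda q G k d (l (d + k)%N) m)%:E @[d --> \oo] --> M [set m].

End Characters.

(* Main.v *)
Require Import Defs.
From mathcomp Require Import all_boot all_order all_algebra perm finmap.
From mathcomp Require Import all_classical all_reals all_analysis.
From mathcomp Require Import ring lra zify.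
Import Order.TTheory GRing.Theory Num.Theory.
Import numFieldNormedType.Exports.

(** With u = z + 1/z, the determinant entries of the three types are polynomials
    f_l(u) obeying one recurrence f_(l+2) = u f_(l+1) - f_l, and a character is
    det[f_(l_i)(u_j)] divided by the Vandermonde determinant of the u_j, where
    l_i = lambda_i + N - i. One argument therefore serves B, C and D.

    Why the law of large numbers holds. Specialize the last variable to
    a = q^(N + eps). Row differences and the Christoffel-Darboux identity expand
    the determinant of size N + 1 into determinants of size N with explicit
    nonnegative coefficients ([branch_det]): the sum runs over pairs of strict
    sequences nu, h with l_(i+1) < nu_i <= l_i and nu_(i+1) <= h_i < nu_i, where
    h_i = mu_i + N - i. Since characters are linearly independent
    ([branching_unique]), the row of the kernel at lambda is the law of mu under
    a probability on such pairs ([Lambda1E]). The remaining factor, the character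
    of mu at the q-point, is a product because f_m(q^(j + eps)) is essentially
    symmetric in m and j ([jpoly_dual], [det_qpoint]).

    As a is of order q^N, the most likely position of a pair at the site i is
    nu_i = l_(i+1) + 1, h_i = l_(i+1), which means mu_i = lambda_(i+1): counted
    from the bottom, the part does not move. Resetting one site to this position
    is always compatible with interlacing, and at distance k from the bottom it
    increases the weight by a factor of order at least q^(-N) per unit of displacement
    ([conf_weight_upd]). So one step of the chain changes the k-th lowest part
    with probability O(q^N), uniformly in the starting signature
    ([one_step_stability]).

    Adding these bounds over all levels above L gives a geometric tail: from any
    level down to L the k-th lowest part changes with probability O(q^L)
    ([Lambda_drift_le]). Starting from signatures whose lowest parts are
    y_1, y_2, ... and letting the starting level grow, M_L gives the event
    mu_(L+1-k) <> y_k a mass O(q^L), which tends to 0. *)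

Set Implicit Arguments.
Unset Strict Implicit.
Unset Printing Implicit Defensive.
Local Open Scope ring_scope.

(** * Determinants: row differences, multilinearity, Vandermonde *)

(** Taking differences of consecutive rows is multiplication by a unipotent
    upper triangular matrix; the convention [r n = 0] makes the last row fit
    the same formula. *)
Lemma det_row_diff (R : comNzRingType) (n : nat) (r : nat -> 'I_n -> R) :
  (forall j, r n j = 0) ->
  \det (\matrix_(i < n, j < n) (r i j - r i.+1 j))
    = \det (\matrix_(i < n, j < n) r i j).
Proof.
move=> rn0.
pose U : 'M[R]_n := \matrix_(i, j) ((j == i)%:R - (j == i.+1 :> nat)%:R).
have detU : \det U = 1.
  rewrite -det_tr det_trig.
    by apply: big1 => i _; rewrite !mxE eqxx ltn_eqF // mulr0n subr0.
  apply/is_trig_mxP => i j ij; rewrite !mxE.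
  by rewrite -val_eqE /= !ltn_eqF ?subrr // ltnW.
rewrite -[RHS]mul1r -detU -det_mulmx; congr (\det _).
apply/matrixP => i j; rewrite !mxE.
under eq_bigr do rewrite !mxE mulrBl.
rewrite sumrB; congr (_ - _).
  rewrite (bigD1 i) //= eqxx mul1r big1 ?addr0 // => k /negPf ki.
  by rewrite ki mul0r.
case: (ltnP i.+1 n) => [lt_in|ge_in].
  rewrite (bigD1 (Ordinal lt_in)) //= eqxx mul1r big1 ?addr0 // => k.
  by rewrite -val_eqE /= => /negPf ->; rewrite mul0r.
have -> : i.+1 = n by apply/eqP; rewrite eqn_leq ge_in ltn_ord.
rewrite rn0 big1 // => k _; rewrite ltn_eqF ?mul0r //; exact: ltn_ord.
Qed.

(** Combined with [det_row_diff], this replaces the Cauchy-Binet formula: the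
    index functions that survive in the applications are decreasing by
    themselves, so that no sum over permutations remains. *)
Lemma det_multilinear (R : comNzRingType) (n K : nat)
    (c : 'I_n -> 'I_K -> R) (F : 'I_K -> 'I_n -> R) :
  \det (\matrix_(i < n, j < n) \sum_(k < K) c i k * F k j)
  = \sum_(g : {ffun 'I_n -> 'I_K})
      (\prod_i c i (g i)) * \det (\matrix_(i < n, j < n) F (g i) j).
Proof.
rewrite /determinant.
transitivity (\sum_(s : 'S_n) \sum_(g : {ffun 'I_n -> 'I_K})
    (-1) ^+ s * \prod_i (c i (g i) * F (g i) (s i))).
  apply: eq_bigr => s _; rewrite -mulr_sumr -(bigA_distr_bigA (fun i k => c i k * F k (s i))) /=.
  by congr (_ * _); apply: eq_bigr => i _; rewrite mxE.
rewrite exchange_big /=; apply: eq_bigr => g _.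
rewrite mulr_sumr; apply: eq_bigr => s _.
rewrite big_split /= mulrCA; congr (_ * (_ * _)).
by apply: eq_bigr => i _; rewrite mxE.
Qed.

(** The matrix factors through the Vandermonde matrix and the triangular matrix
    of coefficients. *)
Lemma det_horner_Vandermonde (R : comNzRingType) (n : nat) (p : nat -> {poly R})
    (x : 'I_n -> R) :
  (forall j, (size (p j) <= j.+1)%N) ->
  \det (\matrix_(i < n, j < n) (p j).[x i])
  = (\prod_(j < n) (p j)`_j) *
    \prod_(i < n) \prod_(j < n | (i < j)%N) (x j - x i).
Proof.
move=> sz.
pose C : 'M[R]_n := \matrix_(k, j) (p j)`_k.
have detC : \det C = \prod_(j < n) (p j)`_j.
  rewrite -det_tr det_trig; first by apply: eq_bigr => i _; rewrite !mxE.
  apply/is_trig_mxP => i j ij; rewrite !mxE nth_default //.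
  exact: leq_trans (sz i) _.
have := det_Vandermonde (\row_j x j).
under eq_bigr => i _ do under eq_bigr do rewrite !mxE.
move=> <-; rewrite -detC mulrC -(det_tr (Vandermonde _ _)) -det_mulmx.
congr (\det _); apply/matrixP => i j; rewrite !mxE.
rewrite (horner_coef_wide _ (leq_trans (sz j) (ltn_ord j))).
by apply: eq_bigr => k _; rewrite !mxE mulrC.
Qed.

Lemma det_scale_rows (R : comNzRingType) (n : nat) (d : 'I_n -> R)
    (A : 'I_n -> 'I_n -> R) :
  \det (\matrix_(i < n, j < n) (d i * A i j))
  = \prod_i d i * \det (\matrix_(i < n, j < n) A i j).
Proof.
have -> : \matrix_(i < n, j < n) (d i * A i j)
          = diag_mx (\row_i d i) *m \matrix_(i, j) A i j.
  by apply/matrixP => i j; rewrite mul_diag_mx !mxE.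
by rewrite det_mulmx det_diag; congr (_ * _); apply: eq_bigr => i _; rewrite mxE.
Qed.

Lemma det_scale_cols (R : comNzRingType) (n : nat) (d : 'I_n -> R)
    (A : 'I_n -> 'I_n -> R) :
  \det (\matrix_(i < n, j < n) (A i j * d j))
  = \prod_j d j * \det (\matrix_(i < n, j < n) A i j).
Proof.
rewrite -det_tr -[in RHS]det_tr.
have -> : (\matrix_(i < n, j < n) (A i j * d j))^T
          = \matrix_(i, j) (d i * A j i).
  by apply/matrixP => i j; rewrite !mxE mulrC.
rewrite det_scale_rows; congr (_ * \det _).
by apply/matrixP => i j; rewrite !mxE.
Qed.

Lemma sum_nat_ord (V : nmodType) (K m n : nat) (F : nat -> V) :
  (n <= K)%N ->
  \sum_(m <= i < n) F i = \sum_(i < K | (m <= i < n)%N) F i.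
Proof. by move=> nK; rewrite big_geq_mkord (big_ord_widen_cond K). Qed.

(** * The polynomials behind the characters *)

Section Jacobi.
Variable R : realFieldType.
Implicit Types (G : series_type) (a u : R) (n m : nat).

(** The determinant entry of index n as a polynomial in u = z + 1/z: up to
    normalization, the Jacobi polynomials with parameters +-1/2. The three types
    share the three-term recurrence and differ only in degrees 0 and 1. *)
Fixpoint jpoly G n : {poly R} :=
  if n is n1.+1 then
    if n1 is n2.+1 then 'X * jpoly G n1 - jpoly G n2
    else if G is typeB then 'X + 1 else 'X
  else if G is typeD then 2%:P else 1.

(** The inverse squared norms in the Christoffel-Darboux kernel, up to a common
    factor; the constant 2 of type D is the one polynomial of another norm. *)
Definition jweight G n : R := if (G, n) is (typeD, 0%N) then 2^-1 else 1.

Definition low_weight G a m : R := jweight G m * (jpoly G m).[a].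
Definition top_weight G a n : R := ((jpoly G n).[a] * (jpoly G n.-1).[a])^-1.
Definition cdker G a u n : R := \sum_(m < n) low_weight G a m * (jpoly G m).[u].

Lemma jpoly_rec G n u :
  (jpoly G n.+2).[u] = u * (jpoly G n.+1).[u] - (jpoly G n).[u].
Proof. by rewrite /= hornerD hornerN (mulrC 'X) hornerMX mulrC. Qed.

Lemma jpoly0E G u : (jpoly G 0).[u] = if G is typeD then 2 else 1.
Proof. by case: G => /=; rewrite hornerC. Qed.

Lemma jpoly1E G u : (jpoly G 1).[u] = if G is typeB then u + 1 else u.
Proof. by case: G => /=; rewrite ?hornerD ?hornerX ?hornerC. Qed.

Lemma size_jpoly G n : (size (jpoly G n) <= n.+1)%N.
Proof.
suff : (size (jpoly G n) <= n.+1)%N && (size (jpoly G n.+1) <= n.+2)%N by case/andP.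
elim: n => [|n /andP[IH1 IH2]].
  case: G => /=; rewrite ?size_polyX ?size_polyC ?size_poly1 ?andbT ?leq_b1 //.
  by rewrite -polyC1 size_XaddC.
rewrite IH2; change (jpoly G n.+2) with ('X * jpoly G n.+1 - jpoly G n).
apply: (leq_trans (size_polyD _ _)); rewrite size_polyN geq_max.
rewrite (leq_trans IH1 (leqW (leqnSn _))) andbT.
by rewrite mulrC (leq_trans (size_polyMleq _ _)) // size_polyX addn2.
Qed.

Lemma lead_jpoly G n : (jpoly G n)`_n = if (G, n) is (typeD, 0%N) then 2 else 1.
Proof.
have jpolyS m : (jpoly G m.+1)`_m.+1 = 1.
  elim: m => [|m IH].
    by case: G => /=; rewrite ?coefD ?coefX ?coefC ?addr0.
  change (jpoly G m.+2) with ('X * jpoly G m.+1 - jpoly G m).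
  rewrite coefB coefXM /= IH nth_default ?subr0 //.
  by apply: leq_trans (size_jpoly _ _) _.
case: n => [|n]; last by rewrite jpolyS; case: G {jpolyS}.
by case: G {jpolyS} => /=; rewrite coefC.
Qed.

#[local] Arguments jpoly : simpl never.

(** Induction on n: the recurrence turns the left-hand side at n+1 into the one
    at n plus one new term of the kernel. *)
Lemma jpoly_Christoffel_Darboux G a u n :
  (jpoly G n.+1).[u] * (jpoly G n).[a] - (jpoly G n).[u] * (jpoly G n.+1).[a]
  = (u - a) * cdker G a u n.+1.
Proof.
elim: n => [|n IH].
  rewrite /cdker big_ord1 /low_weight !jpoly0E !jpoly1E /jweight.
  by case: G => /=; field.
rewrite /cdker big_ord_recr -/(cdker _ _ _ _) /= mulrDr -IH.
rewrite !jpoly_rec /low_weight.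
have -> : jweight G n.+1 = 1 by case: G {IH}.
ring.
Qed.

(** The one-step Christoffel-Darboux identities, divided by the values at a,
    telescope. *)
Lemma jpoly_ratio_diff G a u (l' l : nat) :
  (forall n, (jpoly G n).[a] != 0) -> (l' <= l)%N ->
  (jpoly G l).[u] / (jpoly G l).[a] - (jpoly G l').[u] / (jpoly G l').[a]
  = (u - a) * \sum_(l'.+1 <= n < l.+1) top_weight G a n * cdker G a u n.
Proof.
move=> fa0 ll; rewrite big_add1 /= mulr_sumr.
rewrite -(telescope_sumr (fun n => (jpoly G n).[u] / (jpoly G n).[a])) //.
apply: eq_bigr => n _; rewrite mulrCA -jpoly_Christoffel_Darboux /top_weight /=.
by field; rewrite !fa0.
Qed.
End Jacobi.

Arguments jpoly : simpl never.

(** * Specializing the last variable of a determinant *)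

(** Extension by 0 past the last index: the lowest interlacing condition then
    reads 0 <= h_(N-1) < nu_(N-1), like the others. *)
Definition ext0 (N K : nat) (nu : {ffun 'I_N -> 'I_K}) (i : nat) : nat :=
  oapp (fun j => nu j : nat) 0%N (insub i).

Lemma ext0_ord (N K : nat) (nu : {ffun 'I_N -> 'I_K}) (i : 'I_N) :
  ext0 nu i = nu i.
Proof. by rewrite /ext0 valK. Qed.

Lemma ext0_ge (N K : nat) (nu : {ffun 'I_N -> 'I_K}) (i : nat) :
  (N <= i)%N -> ext0 nu i = 0%N.
Proof. by move=> Ni; rewrite /ext0 insubF // ltnNge Ni. Qed.

Definition interlace_top (N K : nat) (l : nat -> nat) (nu : {ffun 'I_N -> 'I_K}) :=
  [forall i : 'I_N, l i.+1 < nu i <= l i]%N.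
Definition interlace_low (N K : nat) (nu h : {ffun 'I_N -> 'I_K}) :=
  [forall i : 'I_N, ext0 nu i.+1 <= h i < nu i]%N.

Lemma prod_if (R : comNzRingType) (I : finType) (b : pred I) (F : I -> R) :
  \prod_i (if b i then F i else 0) = if [forall i, b i] then \prod_i F i else 0.
Proof.
case: ifPn => [/forallP bT|]; first by apply: eq_bigr => i _; rewrite bT.
by rewrite negb_forall => /existsP[i /negPf bi]; rewrite (bigD1 i) //= bi mul0r.
Qed.

Section BranchDet.
Variables (R : realFieldType) (G : series_type) (a : R).
Hypothesis fa0 : forall n, (jpoly R G n).[a] != 0.

(** The weight of a pair l > nu > h of interlacing strict sequences, where h
    encodes the restricted signature and nu is an auxiliary level in between. *)
Definition branch_weight (N K : nat) (l : nat -> nat) (nu h : {ffun 'I_N -> 'I_K}) : R :=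
  if interlace_top l nu && interlace_low nu h
  then \prod_i top_weight G a (nu i) * \prod_i low_weight G a (h i) else 0.

(** Differences of consecutive rows leave in row i only the terms of the kernel
    with index between nu_(i+1) and nu_i; multilinearity then produces the lower
    interlacing condition. *)
Lemma det_cdker (N K : nat) (u : 'I_N -> R) (nu : {ffun 'I_N -> 'I_K}) :
  (forall i : 'I_N, (ext0 nu i.+1 <= nu i)%N) ->
  \det (\matrix_(i < N, j < N) cdker G a (u j) (nu i))
  = \sum_(h : {ffun 'I_N -> 'I_K})
      (if interlace_low nu h then \prod_i low_weight G a (h i) else 0) *
      \det (\matrix_(i < N, j < N) (jpoly R G (h i)).[u j]).
Proof.
move=> nu_dec.
transitivity (\det (\matrix_(i < N, j < N) cdker G a (u j) (ext0 nu i))).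
  by congr (\det _); apply/matrixP => i j; rewrite !mxE ext0_ord.
rewrite -(det_row_diff (r := fun i j => cdker G a (u j) (ext0 nu i))); last first.
  by move=> j; rewrite ext0_ge // /cdker big_ord0.
rewrite [RHS](_ : _ = \sum_(h : {ffun 'I_N -> 'I_K})
    (\prod_(i < N) (if (ext0 nu i.+1 <= h i < nu i)%N then low_weight G a (h i) else 0)) *
      \det (\matrix_(i < N, j < N) (jpoly R G (h i)).[u j])); last first.
  by apply: eq_bigr => h _; rewrite prod_if.
rewrite -(det_multilinear
  (fun i k => if (ext0 nu i.+1 <= k < nu i)%N then low_weight G a k else 0)
  (fun k j => (jpoly R G k).[u j])).
congr (\det _); apply/matrixP => i j; rewrite !mxE ext0_ord /cdker.
rewrite -(big_mkord xpredT (fun m => low_weight G a m * (jpoly R G m).[u j])).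
rewrite -(big_mkord xpredT (fun m => low_weight G a m * (jpoly R G m).[u j])).
rewrite (@big_cat_nat _ _ _ (ext0 nu i.+1)) //= addrAC subrr add0r.
rewrite (@sum_nat_ord _ K) 1?ltnW //.
by rewrite big_mkcond; apply: eq_bigr => k _; case: ifP; rewrite ?mul0r.
Qed.

(** Divide row i by its last entry and subtract the next row: the last column
    collapses to one entry, and the other entries are differences covered by
    [jpoly_ratio_diff]. Expanding them produces nu, and [det_cdker] produces h.
    For a >= 2 all weights are nonnegative. *)
Lemma branch_det (N K : nat) (l : nat -> nat) (u : 'I_N -> R) :
  (forall i, (i < N)%N -> (l i.+1 <= l i)%N) -> (l 0%N < K)%N ->
  \det (\matrix_(i < N.+1, j < N.+1)
          (jpoly R G (l i)).[oapp u a (unlift ord_max j)])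
  = \prod_(i < N.+1) (jpoly R G (l i)).[a] * \prod_(j < N) (u j - a) *
    \sum_(nu : {ffun 'I_N -> 'I_K}) \sum_(h : {ffun 'I_N -> 'I_K})
      branch_weight l nu h * \det (\matrix_(i < N, j < N) (jpoly R G (h i)).[u j]).
Proof.
move=> l_dec lK.
have lK' i : (i <= N)%N -> (l i < K)%N.
  by elim: i => // i IH iN; apply: leq_ltn_trans (l_dec _ iN) (IH (ltnW iN)).
pose ua (j : 'I_N.+1) := oapp u a (unlift ord_max j).
pose F i (j : 'I_N.+1) := (jpoly R G (l i)).[ua j] / (jpoly R G (l i)).[a].
transitivity (\det (\matrix_(i < N.+1, j < N.+1) ((jpoly R G (l i)).[a] * F i j))).
  by congr (\det _); apply/matrixP => i j; rewrite !mxE /F mulrC divfK.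
rewrite (det_scale_rows (fun i : 'I_N.+1 => (jpoly R G (l i)).[a])
  (fun i j => F i j)) -mulrA; congr (_ * _).
pose r i j := if (i < N.+1)%N then F i j else 0.
transitivity (\det (\matrix_(i < N.+1, j < N.+1) r i j)).
  by congr (\det _); apply/matrixP => i j; rewrite !mxE /r ltn_ord.
rewrite -det_row_diff; last by move=> j; rewrite /r ltnn.
(* After division by the values at a, the last column is constant. *)
have F1 i : F i ord_max = 1 by rewrite /F /ua unlift_none divff.
rewrite (expand_det_col _ ord_max) (bigD1 ord_max) //= big1 ?addr0; last first.
  move=> i; rewrite -val_eqE /= => iN; rewrite mxE /r.
  have iN' : (i < N)%N by rewrite ltn_neqAle iN -ltnS ltn_ord.
  by rewrite ltn_ord ltnS iN' !F1 subrr mul0r.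
rewrite mxE /r /= ltnSn ltnn subr0 F1 mul1r /cofactor /=.
rewrite addnn -signr_odd odd_double expr0 mul1r.
transitivity (\det (\matrix_(i < N, j < N)
    ((\sum_(n < K) (if (l i.+1 < n <= l i)%N then top_weight G a n else 0)
                   * cdker G a (u j) n) * (u j - a)))).
  congr (\det _); apply/matrixP => i j; rewrite !mxE /r.
  have -> : (lift ord_max i < N.+1)%N by exact: ltn_ord.
  rewrite lift_max ltnS ltn_ord /F /ua liftK /=.
  rewrite jpoly_ratio_diff ?l_dec // mulrC; congr (_ * _).
  rewrite (@sum_nat_ord _ K) ?lK' 1?ltnW //.
  by rewrite big_mkcond; apply: eq_bigr => k _; rewrite ltnS; case: ifP; rewrite ?mul0r.
rewrite (det_scale_cols (fun j => u j - a) (fun i j =>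
  \sum_(n < K) (if (l i.+1 < n <= l i)%N then top_weight G a n else 0)
                   * cdker G a (u j) n)); congr (_ * _).
rewrite (det_multilinear
  (fun i (n : 'I_K) => if (l i.+1 < n <= l i)%N then top_weight G a n else 0)
  (fun n j => cdker G a (u j) n)).
apply: eq_bigr => nu _; rewrite prod_if -/(interlace_top l nu).
rewrite /branch_weight; case: ifPn => [itl|_]; last first.
  by rewrite mul0r big1 // => h _; rewrite mul0r.
rewrite det_cdker; last first.
  move=> i; case: (ltnP i.+1 N) => iN; last by rewrite ext0_ge.
  rewrite -[i.+1]/(nat_of_ord (Ordinal iN)) ext0_ord.
  have /forallP/(_ i)/andP[lt_nu _] := itl.
  by have /forallP/(_ (Ordinal iN))/andP[_ /leq_trans->] := itl; rewrite //= ltnW.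
rewrite mulr_sumr; apply: eq_bigr => h _ /=.
by case: ifP; rewrite ?mulrA // mul0r mulr0 mul0r.
Qed.
End BranchDet.

(** * Interlacing configurations and geometric sums *)

Definition upd (N K : nat) (g : {ffun 'I_N -> 'I_K}) (i0 : 'I_N) (v : 'I_K)
  : {ffun 'I_N -> 'I_K} := [ffun i => if i == i0 then v else g i].

Lemma updE (N K : nat) (g : {ffun 'I_N -> 'I_K}) (i0 : 'I_N) (v : 'I_K) (i : 'I_N) :
  upd g i0 v i = if i == i0 then v else g i.
Proof. by rewrite ffunE. Qed.

Section Interlacing.
Variables (N K : nat) (l : nat -> nat) (nu h : {ffun 'I_N -> 'I_K}).
Hypothesis l_dec : forall i, (i < N)%N -> (l i.+1 < l i)%N.
Hypothesis itl : interlace_top l nu && interlace_low nu h.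

Lemma interlace_topP (i : 'I_N) : (l i.+1 < nu i <= l i)%N.
Proof. by case/andP: itl => /forallP. Qed.

Lemma interlace_lowP (i : 'I_N) : (ext0 nu i.+1 <= h i < nu i)%N.
Proof. by case/andP: itl => _ /forallP. Qed.

Lemma interlace_next (i j : 'I_N) : j = i.+1 :> nat -> (nu j <= h i)%N.
Proof. by move=> ji; have := interlace_lowP i; rewrite -ji ext0_ord => /andP[]. Qed.

Lemma interlace_top_le_low (d : nat) (i j : 'I_N) :
  (i + d.+1 = j)%N -> (nu j + d <= h i)%N.
Proof.
elim: d i => [|d IH] i ij; first by rewrite addn0 interlace_next // -ij addn1.
have i1 : (i.+1 < N)%N by apply: leq_ltn_trans (ltn_ord j); lia.
have /IH : (Ordinal i1 + d.+1 = j)%N by rewrite /= -ij; lia.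
have := interlace_next (erefl : Ordinal i1 = i.+1 :> nat).
have /andP[_] := interlace_lowP (Ordinal i1).
lia.
Qed.

Lemma interlace_low_decr (i j : 'I_N) : (i < j)%N -> (h j < h i)%N.
Proof.
move=> ij; have ji : (i + (j - i.+1).+1 = j)%N by lia.
have := interlace_top_le_low ji; have /andP[_] := interlace_lowP j; lia.
Qed.

Lemma l_le (i j : nat) : (i <= j <= N)%N -> (l j <= l i)%N.
Proof.
elim: j => [|j IH]; first by rewrite leqn0 andbT => /eqP ->.
move=> /andP[]; rewrite leq_eqVlt => /predU1P[-> //|ij jN].
by apply: leq_trans (ltnW (l_dec jN)) (IH _); rewrite -ltnS ij ltnW.
Qed.

Lemma interlace_low_above (i i0 : 'I_N) :
  (i < i0)%N -> (l i0.+1 + (i0 - i) <= h i)%N.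
Proof.
move=> ii; have ji : (i + (i0 - i.+1).+1 = i0)%N by lia.
have := interlace_top_le_low ji; have /andP[] := interlace_topP i0; lia.
Qed.

Lemma interlace_low_below (i0 j : 'I_N) : (i0 < j)%N -> (h j < l i0.+1)%N.
Proof.
move=> ij; have /andP[_ h1] := interlace_lowP j; have /andP[_ h2] := interlace_topP j.
apply: leq_trans h1 (leq_trans h2 (l_le _)).
by rewrite ij ltnW.
Qed.

(** The configuration with nu_i = l_(i+1) + 1 and h_i = l_(i+1) imposes the
    weakest conditions on the neighbours, so a site can be reset to it without
    leaving the interlacing configurations. *)
Lemma interlace_upd (i0 : 'I_N) (P0 P1 : 'I_K) :
  P0 = l i0.+1 :> nat -> P1 = (l i0.+1).+1 :> nat ->
  interlace_top l (upd nu i0 P1) && interlace_low (upd nu i0 P1) (upd h i0 P0).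
Proof.
move=> eP0 eP1; apply/andP; split; apply/forallP => i; rewrite !updE.
  case: eqP => [->|_]; last exact: interlace_topP.
  by rewrite eP1 ltnSn l_dec.
have ext0_le : (ext0 (upd nu i0 P1) i.+1 <= ext0 nu i.+1)%N.
  case: (ltnP i.+1 N) => iN; last by rewrite !ext0_ge.
  rewrite -[i.+1]/(nat_of_ord (Ordinal iN)) !ext0_ord updE.
  case: eqP => [->|//]; rewrite eP1; by have /andP[] := interlace_topP i0.
case: eqP => [ii|_].
  rewrite eP0 eP1 ltnSn andbT; apply: leq_trans ext0_le _; rewrite -ii.
  case: (ltnP i.+1 N) => iN; last by rewrite ext0_ge.
  rewrite -[i.+1]/(nat_of_ord (Ordinal iN)) ext0_ord.
  by have /andP[_] := interlace_topP (Ordinal iN); rewrite /=.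
by have /andP[h1 ->] := interlace_lowP i; rewrite (leq_trans ext0_le h1).
Qed.
End Interlacing.

Lemma geo_le2 (R : realFieldType) (B : R) (n : nat) :
  0 <= B -> B <= 2^-1 -> \sum_(j < n) B ^+ j <= 2.
Proof.
move=> B0 B2; suff : \sum_(j < n) B ^+ j <= 2 - 2 * B ^+ n.
  by move=> /le_trans; apply; rewrite gerBl mulr_ge0 ?exprn_ge0.
elim: n => [|n IH]; first by rewrite big_ord0 expr0; lra.
rewrite big_ord_recr /= (le_trans (lerD IH (lexx _))) // exprS.
have : 0 <= B ^+ n by rewrite exprn_ge0.
by move=> p0; nra.
Qed.

(** Distinct exponents: the sum is part of a geometric series of ratio at
    most 1/2. *)
Lemma geo_inj_le2 (R : realFieldType) (B : R) (K : nat) (P : pred 'I_K)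
    (x : 'I_K -> nat) :
  0 <= B -> B <= 2^-1 -> {in P &, injective x} -> (forall i, P i -> (x i < K)%N) ->
  \sum_(i < K | P i) B ^+ (x i) <= 2.
Proof.
move=> B0 B2 xI xK; case: K => [|K] in P x xI xK *; first by rewrite big_ord0.
apply: le_trans (geo_le2 K.+1 B0 B2).
have -> : \sum_(i < K.+1 | P i) B ^+ (x i)
        = \sum_(j in (fun i => inord (x i) : 'I_K.+1) @: [set i | P i]%SET) B ^+ j.
  rewrite big_imset /=; first last.
    move=> i j; rewrite !inE => Pi Pj /(congr1 (@nat_of_ord _)).
    by rewrite !inordK ?xK // => /xI; apply.
  by apply: eq_big => i; rewrite ?inE // => Pi; rewrite inordK ?xK.
rewrite [leRHS](bigID (mem ((fun i => inord (x i) : 'I_K.+1) @: [set i | P i]%SET))) /=.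
by rewrite lerDl sumr_ge0 // => i _; rewrite exprn_ge0.
Qed.

Lemma geo_above_le2 (R : realFieldType) (B : R) (K M : nat) :
  0 <= B -> B <= 2^-1 -> \sum_(n < K | (M < n)%N) B ^+ (n.-1 - M) <= 2.
Proof.
move=> B0 B2; apply: geo_inj_le2 => //.
  by move=> i j; rewrite -!topredE /= => Mi Mj ij; apply: val_inj => /=; lia.
by move=> i Mi; have := ltn_ord i; lia.
Qed.

Lemma geo_dist_le (R : realFieldType) (B : R) (K : nat) (P0 : 'I_K) :
  0 <= B -> B <= 2^-1 ->
  \sum_(p < K | p != P0) B ^+ ((p - P0) + (P0 - p)) <= 4 * B.
Proof.
move=> B0 B2; have -> : 4 * B = 2 * B + 2 * B by ring.
rewrite (bigID (fun p : 'I_K => (P0 < p)%N)) /=; apply: lerD.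
  rewrite (eq_big (fun p : 'I_K => (P0 < p)%N) (fun p => B ^+ (p.-1 - P0) * B)).
  - by rewrite -mulr_suml ler_wpM2r // geo_above_le2.
  - by move=> p; rewrite -val_eqE /=; lia.
  - by move=> p /andP[_ pP]; rewrite -exprSr; congr (_ ^+ _); lia.
rewrite (eq_big (fun p : 'I_K => (p < P0)%N) (fun p => B ^+ (P0 - p.+1) * B)).
- rewrite -mulr_suml ler_wpM2r //; apply: geo_inj_le2 => //.
    by move=> i j; rewrite -!topredE /= => Mi Mj ij; apply: val_inj => /=; lia.
  by move=> i Mi; have := ltn_ord P0; lia.
- by move=> p; rewrite -val_eqE /=; lia.
- move=> p /andP[]; rewrite -val_eqE /= => pn pP.
  by rewrite -exprSr; congr (_ ^+ _); lia.
Qed.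

(** * Weight estimate at one site *)

(** The estimate uses growth properties only. In the application f_n is the
    value of the n-th polynomial at the last variable, S and X are the
    denominators and the values of z + 1/z at the q-points, and
    beta n = 1 - q^n. Then tau = O(q^N) carries the decay, while A and c depend
    on q and the type alone. *)
Section Estimate.
Variables (R : realFieldType) (f jweight S X beta : nat -> R) (tau A c : R).
Hypothesis f_gt0 : forall n, 0 < f n.
Hypothesis tau_gt0 : 0 < tau.
Hypothesis tau_le1 : tau <= 1.
Hypothesis f_ratio : forall n, f n <= tau * f n.+1.
Hypothesis jweight_gt0 : forall n, 0 < jweight n.
Hypothesis jweight_ratio : forall m n, jweight m <= 2 * jweight n.
Hypothesis A_ge1 : 1 <= A.
Hypothesis S_gt0 : forall n, 0 < S n.
Hypothesis S_incr : forall n, S n <= S n.+1.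
Hypothesis S_ratio : forall n, S n.+1 <= A * S n.
Hypothesis X_incr : forall n, X n < X n.+1.
Hypothesis X_ratio : forall m n, (m < n)%N -> X n.+1 - X m <= A * (X n - X m).
Hypothesis beta_gt0 : forall n, (0 < n)%N -> 0 < beta n.
Hypothesis beta_le1 : forall n, beta n <= 1.
Hypothesis beta_incr : forall m n, (m <= n)%N -> beta m <= beta n.
Hypothesis X_beta : forall m p p', (p < p')%N -> (p' < m)%N ->
  (X m - X p) * beta (m - p') <= X m - X p'.
Hypothesis c_gt0 : 0 < c.
Hypothesis beta_prod : forall n, c <= \prod_(i < n) beta i.+1.

Lemma f_iter n r : f n <= tau ^+ r * f (n + r).
Proof.
elim: r => [|r IH]; first by rewrite addn0 mul1r.
apply: le_trans IH _; rewrite addnS exprSr -mulrA ler_wpM2l //.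
by rewrite exprn_ge0 // ltW.
Qed.

Lemma f_leq m n : (m <= n)%N -> f m <= tau ^+ (n - m) * f n.
Proof. by move=> mn; have := f_iter m (n - m); rewrite subnKC. Qed.

Lemma f_mono m n : (m <= n)%N -> f m <= f n.
Proof.
move=> /f_leq /le_trans; apply; rewrite ler_piMl ?(ltW (f_gt0 n)) //.
by rewrite exprn_ile1 // ltW.
Qed.

Lemma X_lt m n : (m < n)%N -> X m < X n.
Proof. exact: (homo_ltn lt_trans X_incr). Qed.

Lemma X_le m n : (m <= n)%N -> X m <= X n.
Proof. by rewrite leq_eqVlt => /predU1P[->//|/X_lt/ltW]. Qed.

Lemma A_ge0 : 0 <= A. Proof. exact: le_trans ler01 A_ge1. Qed.

Lemma S_bound p p' : S p <= A ^+ ((p - p') + (p' - p)) * S p'.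
Proof.
have S0 n : 0 <= S n by apply: ltW.
case: (leqP p p') => pp.
  have SS : S p <= S p' by exact: (homo_leq lexx le_trans S_incr).
  by apply: le_trans SS _; rewrite ler_peMl // exprn_ege1.
have -> : (p - p' + (p' - p) = p - p')%N by lia.
rewrite -[p in leLHS](subnKC (ltnW pp)).
elim: (p - p')%N => [|r IH]; first by rewrite addn0 mul1r.
rewrite addnS exprS -mulrA (le_trans (S_ratio _)) // ler_wpM2l ?A_ge0 //.
Qed.

Lemma X_bound m p p' : (m < p)%N -> (m < p')%N ->
  X p - X m <= A ^+ ((p - p') + (p' - p)) * (X p' - X m).
Proof.
move=> mp mp'.
case: (leqP p p') => pp.
  apply: (@le_trans _ _ (X p' - X m)); first by rewrite lerD2r X_le.
  by rewrite ler_peMl ?exprn_ege1 // subr_ge0 X_le // ltnW.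
have -> : (p - p' + (p' - p) = p - p')%N by lia.
rewrite -[p in leLHS](subnKC (ltnW pp)).
elim: (p - p')%N => [|r IH]; first by rewrite addn0 mul1r.
rewrite addnS exprS -mulrA (le_trans (X_ratio _)) ?ler_wpM2l ?A_ge0 //.
by rewrite ltn_addr.
Qed.

(** With p = h_i, p' = l_(i+1) and n = nu_i, this is the effect of the reset on
    the weights that depend on the last variable: a factor tau for each unit of
    the displacement of p, and for each unit by which n exceeds the least value
    that p and p' allow. *)
Lemma f_bound p p' n : (p < n)%N -> (p' < n)%N ->
  f p * f p'.+1
  <= tau ^+ ((p - p') + (p' - p) + (n.-1 - maxn p p')) * (f n * f n.-1).
Proof.
move=> pn p'n; have f0 m : 0 <= f m by apply: ltW.
have t0 m : 0 <= tau ^+ m by rewrite exprn_ge0 // ltW.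
case: (leqP p p') => pp.
  have -> : (p - p' + (p' - p) + (n.-1 - p') = (p' - p) + (n.-1 - p'))%N by lia.
  rewrite exprD (mulrC (f n)) mulrA; apply: ler_pM => //; last exact: f_mono.
  apply: le_trans (f_leq pp) _; rewrite -mulrA ler_wpM2l // f_leq //; lia.
have -> : (p - p' + (p' - p) + (n.-1 - p) = (n.-1 - p) + (p - p'))%N by lia.
rewrite exprD (mulrC (f n)) mulrACA.
rewrite ler_pM //; first by rewrite f_leq //; lia.
apply: le_trans (f_leq p'n) _; rewrite ler_wpM2r //.
by apply: ler_wiXn2l; [exact: ltW | exact: tau_le1 | lia].
Qed.

Section Config.
Variables (N K : nat) (l : nat -> nat).
Hypothesis l_dec : forall i, (i < N)%N -> (l i.+1 < l i)%N.

Local Notation conf := ({ffun 'I_N -> 'I_K} * {ffun 'I_N -> 'I_K})%type.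

Definition Vdiff (h : {ffun 'I_N -> 'I_K}) : R :=
  \prod_(i < N) \prod_(j < N | (i < j)%N) (X (h i) - X (h j)).

(** The weight of an interlacing pair in the kernel applied to l, up to a
    factor independent of the pair: the branching weight times the product
    formula for the character of h at the q-point. *)
Definition conf_weight (om : conf) : R :=
  if interlace_top l om.1 && interlace_low om.1 om.2 then
    \prod_i (f (om.1 i) * f (om.1 i).-1)^-1 *
    \prod_i (jweight (om.2 i) * f (om.2 i)) *
    (\prod_i S (om.2 i) * Vdiff om.2)
  else 0.

Lemma Vdiff_gt0 nu h : interlace_top l nu && interlace_low nu h -> 0 < Vdiff h.
Proof.
move=> itl; apply: prodr_gt0 => i _; apply: prodr_gt0 => j ij.
by rewrite subr_gt0 X_lt // (interlace_low_decr itl).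
Qed.

Lemma conf_weight_ge0 om : 0 <= conf_weight om.
Proof.
rewrite /conf_weight; case: ifP => // itl.
rewrite !mulr_ge0 ?(ltW (Vdiff_gt0 itl)) //; apply: prodr_ge0 => i _.
- by rewrite invr_ge0 mulr_ge0 // ltW.
- by rewrite mulr_ge0 // ltW.
- by rewrite ltW.
Qed.

Variables (i0 : 'I_N) (P0 P1 : 'I_K).
Hypothesis eP0 : P0 = l i0.+1 :> nat.
Hypothesis eP1 : P1 = (l i0.+1).+1 :> nat.

Let dist (p : nat) := ((p - P0) + (P0 - p))%N.

(** Factors with a larger h_j change by at most 1/beta(i0 - j), because the
    entries above i0 are at distinct distances at least i0 - j from the new
    value; the product of these bounds stays below 1/c whatever N is. Each of
    the N - i0 - 1 factors with a smaller h_j changes by at most A to the power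
    of the displacement. *)
Lemma Vdiff_upd nu h : interlace_top l nu && interlace_low nu h ->
  Vdiff h <= c^-1 * (A ^+ dist (h i0)) ^+ (N - i0.+1) * Vdiff (upd h i0 P0).
Proof.
move=> itl; set r := dist _.
have A0 := A_ge0; have Ar0 : 0 <= A ^+ r by rewrite exprn_ge0.
have Ar1 : 1 <= A ^+ r by rewrite exprn_ege1.
(* Factor by factor: F1 bounds the pairs (i, i0) and F2 the pairs (i0, j). *)
pose F1 (i j : 'I_N) : R := if j == i0 then (beta (i0 - i))^-1 else 1.
pose F2 (i j : 'I_N) : R := if i == i0 then A ^+ r else 1.
have itl' := interlace_upd l_dec itl eP0 eP1.
have Vd'_gt0 := Vdiff_gt0 itl'.
have step : Vdiff h <= \prod_(i < N) \prod_(j < N | (i < j)%N)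
      (F1 i j * F2 i j * (X (upd h i0 P0 i) - X (upd h i0 P0 j))).
  apply: ler_prod => i _; apply/andP; split.
    apply: prodr_ge0 => j ij; rewrite subr_ge0 X_le // ltnW //.
    exact: (interlace_low_decr itl).
  apply: ler_prod => j ij; rewrite subr_ge0 X_le /=; last first.
    exact/ltnW/(interlace_low_decr itl).
  have hij := interlace_low_decr itl ij.
  rewrite !updE /F1 /F2; case: eqP => [jE|_]; case: eqP => [iE|_].
  - by move: ij; rewrite iE jE ltnn.
  - have ij0 : (i < i0)%N by rewrite -jE.
    have b0 : 0 < beta (i0 - i) by rewrite beta_gt0 // subn_gt0.
    have hi := interlace_low_above itl ij0.
    have P0hi : (P0 < h i)%N by rewrite eP0; apply: leq_trans hi; rewrite -addn1 leq_add2l subn_gt0.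
    rewrite mulr1 mulrC ler_pdivlMr // jE.
    case: (ltnP (h i0) P0) => hP.
      apply: le_trans (X_beta hP P0hi); rewrite ler_wpM2l //.
        by rewrite subr_ge0 X_le // ltnW // -jE.
      by apply: beta_incr; rewrite leq_subRL ?(ltnW P0hi) // eP0.
    apply: (@le_trans _ _ (X (h i) - X (h i0))).
      by rewrite ler_piMr // subr_ge0 X_le // ltnW // -jE.
    by rewrite lerB // X_le.
  - rewrite mul1r iE; apply: X_bound; first by rewrite -iE.
    by rewrite eP0; apply: (interlace_low_below l_dec itl); rewrite -iE.
  - by rewrite !mul1r.
apply: le_trans step _.
under eq_bigr => i _ do rewrite !big_split /=.
rewrite !big_split /=.
apply: ler_wpM2r; first exact: ltW.
have -> : \prod_(i < N) \prod_(j < N | (i < j)%N) F2 i j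
          = (A ^+ r) ^+ (N - i0.+1).
  rewrite (bigD1 i0) //= [X in _ * X]big1 ?mulr1; last first.
    by move=> i /negPf ii; apply: big1 => j _; rewrite /F2 ii.
  under eq_bigr do rewrite /F2 eqxx.
  by rewrite -(big_geq_mkord i0.+1 N xpredT (fun=> A ^+ r)) prodr_const_nat.
apply: ler_wpM2r; first by rewrite exprn_ge0.
have -> : \prod_(i < N) \prod_(j < N | (i < j)%N) F1 i j
          = \prod_(i < N | (i < i0)%N) (beta (i0 - i))^-1.
  rewrite [RHS]big_mkcond; apply: eq_bigr => i _; case: ifP => ii.
    rewrite (bigD1 i0) //= {1}/F1 eqxx big1 ?mulr1 // => j /andP[_ /negPf jj].
    by rewrite /F1 jj.
  by apply: big1 => j ij; rewrite /F1; case: eqP => // jj; rewrite -jj ij in ii.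
rewrite prodfV lef_pV2 ?posrE //; last first.
  by apply: prodr_gt0 => i ii; rewrite beta_gt0 // subn_gt0.
apply: le_trans (beta_prod i0) _.
rewrite (reindex_inj rev_ord_inj) /= (big_ord_widen_cond N xpredT (fun i => beta (i0 - i.+1).+1)); last exact: ltnW.
rewrite le_eqVlt; apply/orP; left; apply/eqP.
by apply: eq_bigr => i /= ii; rewrite subnSK.
Qed.

(** The growth A^(N - i0) per unit of displacement is independent of N when
    i0 stays at a fixed distance from the bottom, so the factor tau wins. *)
Lemma conf_weight_upd nu h : interlace_top l nu && interlace_low nu h ->
  conf_weight (nu, h) <= 2 * c^-1 * (tau * A ^+ (N - i0)) ^+ dist (h i0)
       * tau ^+ ((nu i0).-1 - maxn (h i0) P0)
       * conf_weight (upd nu i0 P1, upd h i0 P0).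
Proof.
move=> itl; rewrite /conf_weight /= itl (interlace_upd l_dec itl eP0 eP1).
set r := dist _; set t := (_.-1 - _)%N.
have A0 := A_ge0; have f0 m : 0 <= f m by apply: ltW.
have itl' := interlace_upd l_dec itl eP0 eP1.
have /andP[_ hnu] := interlace_lowP itl i0.
have /andP[lnu _] := interlace_topP itl i0.
have t0 m : 0 <= tau ^+ m by rewrite exprn_ge0 // ltW.
rewrite !(bigD1 i0 (P := xpredT)) //= !updE eqxx.
have rest (F : nat -> R) (g : {ffun 'I_N -> 'I_K}) v :
    \prod_(i < N | i != i0) F (upd g i0 v i) = \prod_(i < N | i != i0) F (g i).
  by apply: eq_bigr => i /negPf ii; rewrite updE ii.
rewrite (rest (fun m => (f m * f m.-1)^-1)) (rest (fun m => jweight m * f m)) (rest S).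
set a1 := \prod_(i | _) _; set a2 := \prod_(i | _) _; set a3 := \prod_(i | _) _.
have a1_ge0 : 0 <= a1.
  by apply: prodr_ge0 => i _; rewrite invr_ge0 mulr_ge0.
have a2_ge0 : 0 <= a2 by apply: prodr_ge0 => i _; rewrite mulr_ge0 // ltW.
have a3_ge0 : 0 <= a3 by apply: prodr_ge0 => i _; rewrite ltW.
have Vb := Vdiff_upd itl; rewrite -/r in Vb.
have Sb : S (h i0) <= A ^+ r * S P0 by exact: S_bound.
have Fb : (f (nu i0) * f (nu i0).-1)^-1 * (jweight (h i0) * f (h i0))
    <= 2 * tau ^+ (r + t) * ((f P1 * f P1.-1)^-1 * (jweight P0 * f P0)).
  have P1E : P1 = P0.+1 :> nat by rewrite eP0 eP1.
  rewrite P1E /=.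
  have -> : (f P0.+1 * f P0)^-1 * (jweight P0 * f P0) = jweight P0 / f P0.+1.
    by field; rewrite !gt_eqF.
  rewrite mulrC ler_pdivrMr ?mulr_gt0 //.
  have -> : 2 * tau ^+ (r + t) * (jweight P0 / f P0.+1) * (f (nu i0) * f (nu i0).-1)
     = (2 * jweight P0) * (tau ^+ (r + t) * (f (nu i0) * f (nu i0).-1)) / f P0.+1 by ring.
  rewrite ler_pdivlMr // -[leLHS]mulrA.
  apply: ler_pM; rewrite ?mulr_ge0 //; first exact: ltW.
  have P0nu : (P0 < nu i0)%N by rewrite eP0.
  exact: (f_bound hnu P0nu).
set w1 := (f (nu i0) * _)^-1 in Fb *; set e1 := jweight _ * f (h i0) in Fb *.
set w2 := (f P1 * _)^-1 in Fb *; set e2 := jweight _ * f P0 in Fb *.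
have V0 : 0 <= Vdiff h by exact/ltW/(Vdiff_gt0 itl).
have w10 : 0 <= w1 * e1 by rewrite mulr_ge0 ?invr_ge0 ?mulr_ge0 // ltW.
have S0 : 0 <= S (h i0) by exact: ltW.
have M1 := ler_pM S0 V0 Sb Vb.
have M2 := ler_pM w10 (mulr_ge0 S0 V0) Fb M1.
have -> : w1 * a1 * (e1 * a2) * (S (h i0) * a3 * Vdiff h)
   = (a1 * a2 * a3) * (w1 * e1 * (S (h i0) * Vdiff h)) by ring.
have -> : 2 / c * (tau * A ^+ (N - i0)) ^+ r * tau ^+ t
   * (w2 * a1 * (e2 * a2) * (S P0 * a3 * Vdiff (upd h i0 P0)))
 = (a1 * a2 * a3) * (2 * tau ^+ (r + t) * (w2 * e2)
   * (A ^+ r * S P0 * (c^-1 * (A ^+ r) ^+ (N - i0.+1) * Vdiff (upd h i0 P0)))).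
  have EA : (A ^+ (N - i0)) ^+ r = A ^+ r * (A ^+ r) ^+ (N - i0.+1).
    by rewrite -(subnSK (ltn_ord i0)) -exprM mulnC exprM exprS.
  by rewrite exprMn EA exprD; ring.
by rewrite ler_wpM2l ?mulr_ge0.
Qed.

(** The reset map is injective once the old values at the site are given, so
    summing [conf_weight_upd] over these values, a double geometric series,
    bounds the weight of all configurations that are not in the reset position
    at i0 by a multiple of tau A^(N - i0) times the total weight. *)
Lemma conf_weight_bad : tau * A ^+ (N - i0) <= 2^-1 ->
  \sum_(om : conf | om.2 i0 != P0) conf_weight om
  <= 16 * c^-1 * (tau * A ^+ (N - i0)) * \sum_(om : conf) conf_weight om.
Proof.
set B := tau * _ => B2.
have t0 : 0 <= tau by apply: ltW.
have B0 : 0 <= B by rewrite mulr_ge0 ?exprn_ge0 ?A_ge0.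
have tB : tau <= B by rewrite ler_peMr ?exprn_ege1.
have c0 : 0 <= c^-1 by rewrite invr_ge0 ltW.
set Z := \sum_(om : conf) conf_weight om.
have Z0 : 0 <= Z by apply: sumr_ge0 => om _; apply: conf_weight_ge0.
pose u (om : conf) : conf :=
  (upd om.1 i0 P1, upd om.2 i0 P0).
(* rho bounds the weight ratio in terms of the old values (nu_i0, h_i0). *)
pose rho (x : 'I_K * 'I_K) : R :=
  if (maxn x.2 P0 < x.1)%N && (x.2 != P0) then
    B ^+ dist x.2 * B ^+ (x.1.-1 - maxn x.2 P0) else 0.
have rho0 x : 0 <= rho x by rewrite /rho; case: ifP => // _; rewrite mulr_ge0 ?exprn_ge0.
have step (om : conf) : om.2 i0 != P0 ->
    conf_weight om <= 2 * c^-1 * (rho (om.1 i0, om.2 i0) * conf_weight (u om)).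
  case: om => nu h /= hP; case itl: (interlace_top l nu && interlace_low nu h); last first.
    rewrite {1}/conf_weight /= itl; rewrite !mulr_ge0 // ?conf_weight_ge0 //.
  have /andP[_ hnu] := interlace_lowP itl i0.
  have /andP[lnu _] := interlace_topP itl i0.
  apply: le_trans (conf_weight_upd itl) _; rewrite -/B /rho /= hP andbT gtn_max hnu eP0 lnu.
  rewrite -eP0 -!mulrA ler_wpM2l // ler_wpM2l // ler_wpM2l ?exprn_ge0 //.
  rewrite ler_wpM2r ?conf_weight_ge0 // lerXn2r // nnegrE //.
have fiber x : \sum_(om : conf | (om.2 i0 != P0) && ((om.1 i0, om.2 i0) == x)) conf_weight (u om) <= Z.
  rewrite -(big_imset conf_weight) /=; last first.
    move=> [nu h] [nu' h']; rewrite -!topredE /= => /andP[_ /eqP <-] /andP[_ /eqP[n1 h1]].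
    move=> [/ffunP En /ffunP Eh]; congr (_, _); apply/ffunP => i.
      by have := En i; rewrite !updE; case: eqP => [->|].
    by have := Eh i; rewrite !updE; case: eqP => [->|].
  rewrite /Z [leRHS](bigID (mem (u @: [pred om : conf | (om.2 i0 != P0) && ((om.1 i0, om.2 i0) == x)]))) /=.
  by rewrite lerDl sumr_ge0 // => om _; apply: conf_weight_ge0.
apply: (@le_trans _ _ (2 * c^-1 * \sum_x (rho x * Z))).
  rewrite mulr_sumr (partition_big (fun om : conf => (om.1 i0, om.2 i0)) xpredT) //=.
  apply: ler_sum => x _.
  apply: (@le_trans _ _ (2 * c^-1 * (rho x *
     \sum_(om : conf | (om.2 i0 != P0) && ((om.1 i0, om.2 i0) == x)) conf_weight (u om)))).
    rewrite !mulr_sumr; apply: ler_sum => om /andP[hP /eqP <-]; exact: step.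
  by rewrite ler_wpM2l ?mulr_ge0 // ler_wpM2l.
rewrite -mulr_suml [leLHS]mulrA ler_wpM2r //.
have -> : 16 / c * B = 2 / c * (8 * B) by ring.
rewrite ler_wpM2l ?mulr_ge0 //.
have -> : \sum_x rho x = \sum_(p : 'I_K | p != P0) B ^+ dist p *
    \sum_(n : 'I_K | (maxn p P0 < n)%N) B ^+ (n.-1 - maxn p P0).
  rewrite -(pair_bigA _ (fun n p => rho (n, p))) exchange_big /=.
  rewrite [RHS]big_mkcond; apply: eq_bigr => p _; rewrite /rho /=.
  case: ifPn => hp; last by rewrite big1 // => n _; rewrite andbF.
  rewrite mulr_sumr [RHS]big_mkcond; apply: eq_bigr => n _.
  by rewrite andbT.
apply: (@le_trans _ _ (\sum_(p : 'I_K | p != P0) B ^+ dist p * 2)).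
  apply: ler_sum => p _; rewrite ler_wpM2l ?exprn_ge0 //.
  exact: geo_above_le2.
have -> : 8 * B = 4 * B * 2 by ring.
by rewrite -mulr_suml ler_wpM2r // geo_dist_le.
Qed.
End Config.
End Estimate.

Local Open Scope classical_set_scope.

(** * Character entries as polynomials in z + 1/z *)

Lemma jpoly_uniq (R : realFieldType) (G : series_type) (u : R) (g : nat -> R) :
  g 0%N = (if G is typeD then 2 else 1) ->
  g 1%N = (if G is typeB then u + 1 else u) ->
  (forall n, g n.+2 = u * g n.+1 - g n) ->
  forall n, g n = (jpoly R G n).[u].
Proof.
move=> g0 g1 gS n.
suff [] : g n = (jpoly R G n).[u] /\ g n.+1 = (jpoly R G n.+1).[u] by [].
elim: n => [|n [IH1 IH2]]; first by rewrite jpoly0E jpoly1E.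
by split => //; rewrite gS jpoly_rec IH1 IH2.
Qed.

(** With a square root of z, the half-integer powers of type B become ordinary
    ones. *)
Lemma char_entryB (R : realType) (n : nat) (z : R) : 0 < z ->
  char_entry typeB n z
  = (z ^+ n * Num.sqrt z - (z ^+ n * Num.sqrt z)^-1)
    / (Num.sqrt z - (Num.sqrt z)^-1).
Proof.
move=> z0; rewrite /= !powRN powRD ?(gt_eqF z0) ?implybT //.
by rewrite powR_mulrn ?powR12_sqrt // ltW.
Qed.

Lemma char_entryE (R : realType) (G : series_type) (n : nat) (z : R) :
  0 < z -> z != 1 \/ G = typeD -> char_entry G n z = (jpoly R G n).[z + z^-1].
Proof.
move=> z0 z1; have zn0 : z != 0 by rewrite gt_eqF.
have zX m : z ^+ m != 0 by rewrite expf_neq0.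
case: G z1 => z1.
- have {}z1 : z != 1 by case: z1.
  have [h [h0 hh hE]] : exists h, [/\ h != 0, z = h * h & Num.sqrt z = h].
    exists (Num.sqrt z); split=> //; first by rewrite lt0r_neq0 // sqrtr_gt0.
    by rewrite -expr2 sqr_sqrtr // ltW.
  have h1 : h * h - 1 != 0 by rewrite -hh subr_eq0.
  apply: (@jpoly_uniq R typeB _ (fun n => char_entry typeB n z)) => {n} [||n];
    rewrite !char_entryB // hE.
  + by rewrite mul1r divff // subr_eq0; apply: contra_neq h1 => {1}->; rewrite mulVf ?subrr.
  + by rewrite hh; field; rewrite h0.
  + by rewrite !exprS; have := zX n; set zn := z ^+ n => zn1; rewrite hh; field; rewrite h0 h1.
- have {}z1 : z != 1 by case: z1.
  have z21 : z * z - 1 != 0.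
    rewrite -expr2 subr_eq0 sqrf_eq1 negb_or z1 /=.
    by apply/negP => /eqP zE; lra.
  apply: (@jpoly_uniq R typeC _ (fun n => char_entry typeC n z)) => {n} [||n] /=.
  + by rewrite !expr1; field; rewrite zn0 z21.
  + by rewrite !expr2; field; rewrite zn0 z21.
  + by rewrite !exprS; have := zX n; set zn := z ^+ n => zn1; field; rewrite zn1 zn0 z21.
- apply: (@jpoly_uniq R typeD _ (fun n => char_entry typeD n z)) => {n} [||n] /=.
  + by rewrite !expr0 invr1.
  + by rewrite !expr1.
  + by rewrite !exprS; have := zX n; set zn := z ^+ n => zn1; field; rewrite zn1 zn0.
Qed.

(** * The points q^(j + eps) *)

(** The ratio of consecutive values stays above a/2: if it is r at one step,
    it is a - 1/r at the next one, and a - 2/a >= a/2 for a >= 2. *)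
Lemma jpoly_growth (R : realFieldType) (G : series_type) (a : R) (n : nat) :
  2 <= a -> 0 < (jpoly R G n).[a] /\ a / 2 * (jpoly R G n).[a] <= (jpoly R G n.+1).[a].
Proof.
move=> a2; elim: n => [|n [IH1 IH2]].
  by rewrite jpoly0E jpoly1E; case: G; lra.
have f1 : 0 < (jpoly R G n.+1).[a] by apply: lt_le_trans IH2; rewrite mulr_gt0 //; lra.
by split => //; rewrite jpoly_rec; nra.
Qed.

Lemma jpoly_gt0 (R : realFieldType) (G : series_type) (a : R) (n : nat) :
  2 <= a -> 0 < (jpoly R G n).[a].
Proof. by case/(jpoly_growth G n). Qed.

Lemma jpoly_ratio (R : realFieldType) (G : series_type) (a : R) (n : nat) :
  2 <= a -> (jpoly R G n).[a] <= 2 / a * (jpoly R G n.+1).[a].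
Proof.
move=> a2; have [_ fa] := jpoly_growth G n a2; have a0 : 0 < a by lra.
by rewrite [leRHS]mulrAC ler_pdivlMr // mulrC; lra.
Qed.

Lemma jweight_gt0 (R : realFieldType) (G : series_type) (n : nat) : 0 < jweight R G n.
Proof. by rewrite /jweight; case: G; case: n => // [|n]; rewrite ?invr_gt0. Qed.

Lemma jweight_ratio (R : realFieldType) (G : series_type) (m n : nat) :
  jweight R G m <= 2 * jweight R G n.
Proof. by rewrite /jweight; case: G; case: m => [|m]; case: n => [|n]; lra. Qed.

Lemma uv_sub (R : realFieldType) (x y : R) : x != 0 -> y != 0 ->
  x + x^-1 - (y + y^-1) = (1 - x / y) * (1 - x * y) / x.
Proof. by move=> x0 y0; field; rewrite x0 y0. Qed.

Lemma uv_ge2 (R : realFieldType) (x : R) : 0 < x -> 2 <= x + x^-1.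
Proof.
move=> x0; rewrite -subr_ge0.
have -> : x + x^-1 - 2 = (x - 1) ^+ 2 / x by field; rewrite gt_eqF.
by rewrite divr_ge0 ?sqr_ge0 // ltW.
Qed.

Section QPoint.
Variables (R : realType) (q : R) (G : series_type).
Hypothesis q_gt0 : 0 < q.
Hypothesis q_lt1 : q < 1.

Definition qnode (j : nat) : R := q `^ (j%:R + eps R G).
Definition qcoord (j : nat) : R := qnode j + (qnode j)^-1.
(** Minus the denominator of the determinant entries, with 1 for type D: the
    factor that makes the entries at q-points symmetric in row and column. *)
Definition entry_denom (z : R) : R :=
  match G with
  | typeB => (Num.sqrt z)^-1 - Num.sqrt z | typeC => z^-1 - z | typeD => 1
  end.

Lemma qnode_gt0 j : 0 < qnode j. Proof. exact: powR_gt0. Qed.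

Lemma qnode_neq0 j : qnode j != 0. Proof. by rewrite gt_eqF ?qnode_gt0. Qed.

Lemma qnodeS j : qnode j.+1 = q * qnode j.
Proof.
rewrite /qnode -natr1 -addrA (addrC 1) addrA powRD ?(gt_eqF q_gt0) ?implybT //.
by rewrite powRr1 ?(ltW q_gt0) // mulrC.
Qed.

Lemma qnodeD j r : qnode (j + r) = q ^+ r * qnode j.
Proof. by elim: r => [|r IH]; rewrite ?addn0 ?mul1r // addnS qnodeS IH exprS mulrA. Qed.

Lemma qnode0_le1 : qnode 0 <= 1.
Proof.
rewrite -(powRr0 q) /qnode; apply: ger_powR; first by rewrite q_gt0 ltW.
by rewrite add0r /eps; case: G; rewrite ?invr_ge0.
Qed.

Lemma qnode_leX j : qnode j <= q ^+ j.
Proof.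
rewrite -[j]add0n qnodeD add0n ler_piMr ?qnode0_le1 // exprn_ge0 // ltW //.
Qed.

Lemma qnode_le1 j : qnode j <= 1.
Proof. by rewrite (le_trans (qnode_leX j)) // exprn_ile1 ?(ltW q_gt0) ?(ltW q_lt1). Qed.

Lemma qnode_lt1 j : (0 < j)%N \/ G <> typeD -> qnode j < 1.
Proof.
case=> [|GD].
  case: j => // j _; rewrite qnodeS.
  apply: le_lt_trans q_lt1; rewrite ler_piMr ?qnode_le1 //; exact: ltW.
apply: (@le_lt_trans _ _ (qnode 0)).
  rewrite -[j]add0n qnodeD ler_piMl ?exprn_ile1 ?(ltW q_gt0) ?(ltW q_lt1) //.
  exact/ltW/qnode_gt0.
rewrite /qnode add0r /eps; case: G GD => // _.
  by rewrite powR12_sqrt ?(ltW q_gt0) // -sqrtr1 ltr_sqrt.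
by rewrite powRr1 // ltW.
Qed.

Lemma entry_denom_gt0 j : 0 < entry_denom (qnode j).
Proof.
rewrite /entry_denom; case E: G => //.
- have z1 : qnode j < 1 by apply: qnode_lt1; right; rewrite E.
  have h0 : 0 < Num.sqrt (qnode j) by rewrite sqrtr_gt0 qnode_gt0.
  have h1 : Num.sqrt (qnode j) < 1 by rewrite -sqrtr1 ltr_sqrt.
  by rewrite subr_gt0 (lt_trans h1) // invf_gt1.
- have z1 : qnode j < 1 by apply: qnode_lt1; right; rewrite E.
  by rewrite subr_gt0 (lt_trans z1) // invf_gt1 // qnode_gt0.
Qed.

(** Multiplied by its denominator, the entry of index m at q^(j + eps) only
    depends on q^((m + eps)(j + eps)), because the shift of the exponents is eps
    as well. Hence determinants at q-points are Vandermonde determinants in the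
    row variables. *)
Lemma jpoly_dual m j :
  (jpoly R G m).[qcoord j] * entry_denom (qnode j) = entry_denom (qnode m) * (jpoly R G j).[qcoord m].
Proof.
have key i n : (jpoly R G i).[qcoord n] * entry_denom (qnode n) =
  let t := q `^ ((n%:R + eps R G) * (i%:R + eps R G)) in
  if G is typeD then t + t^-1 else t^-1 - t.
  have zn0 := qnode_gt0 n; have zN := qnode_neq0 n.
  rewrite /qcoord -char_entryE //; last first.
    by case E: G; [left|left|by right]; rewrite lt_eqF // qnode_lt1 //; right; rewrite E.
  rewrite powRrM -[q `^ _]/(qnode n) /=.
  case E: G => /=.
  - rewrite -/(char_entry typeB i (qnode n)) char_entryB // /entry_denom E.
    have z1 : qnode n < 1 by apply: qnode_lt1; right; rewrite E.
    have h0 : 0 < Num.sqrt (qnode n) by rewrite sqrtr_gt0.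
    have h1 : Num.sqrt (qnode n) < 1 by rewrite -sqrtr1 ltr_sqrt.
    rewrite powRD ?zN ?implybT // powR_mulrn ?powR12_sqrt ?(ltW zn0) //.
    set t := qnode n ^+ i * _; move: h0 h1; set h := Num.sqrt _ => h0 h1.
    have t0 : t != 0 by rewrite mulf_neq0 ?expf_neq0 // gt_eqF.
    by field; rewrite t0 gt_eqF //= lt_eqF //; nra.
  - rewrite /entry_denom E natr1 powR_mulrn ?(ltW zn0) //.
    have z1 : qnode n < 1 by apply: qnode_lt1; right; rewrite E.
    have t0 : qnode n ^+ i.+1 != 0 by rewrite expf_neq0.
    move: t0; set t := qnode n ^+ i.+1 => t0.
    by field; rewrite t0 zN /= lt_eqF //; nra.
  - by rewrite /entry_denom E mulr1 addr0 powR_mulrn // ltW.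
by rewrite [RHS]mulrC !key (mulrC (j%:R + _)).
Qed.

Lemma qcoord_incr n : qcoord n < qcoord n.+1.
Proof.
rewrite -subr_gt0 uv_sub ?qnode_neq0 // qnodeS; have z0 := qnode_gt0 n; have z1 := qnode_le1 n.
have -> : q * qnode n / qnode n = q by field; rewrite gt_eqF.
rewrite divr_gt0 ?mulr_gt0 ?qnode_gt0 // ?subr_gt0 //.
rewrite -mulrA; apply: le_lt_trans q_lt1.
by rewrite ler_piMr ?mulr_ile1 ?(ltW q_gt0) ?(ltW z0).
Qed.

Lemma qcoord_le m n : (m <= n)%N -> qcoord m <= qcoord n.
Proof. by apply: (homo_leq lexx le_trans) => i; exact/ltW/qcoord_incr. Qed.

(** Consecutive increments of z + 1/z along z = q^(j + eps) have ratio at most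
    1/(q(1 - q)), and the last increment is at most the whole difference. *)
Lemma qcoord_ratio m n : (m < n)%N ->
  qcoord n.+1 - qcoord m <= (1 + (q * (1 - q))^-1) * (qcoord n - qcoord m).
Proof.
case: n => // n; rewrite ltnS => mn.
have -> : qcoord n.+2 - qcoord m = (qcoord n.+1 - qcoord m) + (qcoord n.+2 - qcoord n.+1) by ring.
rewrite mulrDl mul1r lerD2l.
have qq : 0 < q * (1 - q) by rewrite mulr_gt0 // subr_gt0.
apply: (@le_trans _ _ ((q * (1 - q))^-1 * (qcoord n.+1 - qcoord n))); last first.
  by rewrite ler_wpM2l ?invr_ge0 ?(ltW qq) // lerB // qcoord_le.
rewrite mulrC ler_pdivlMr //.
rewrite /qcoord !qnodeS; have z0 := qnode_gt0 n; have z1 := qnode_le1 n.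
set z := qnode n in z0 z1 *.
have zi : 1 <= z^-1 by rewrite invf_ge1.
rewrite -subr_ge0.
have -> : q * z + (q * z)^-1 - (z + z^-1) -
  (q * (q * z) + (q * (q * z))^-1 - (q * z + (q * z)^-1)) * (q * (1 - q))
  = (1 - q) * ((z^-1 - z) + (1 - q) * q ^+ 2 * z).
  by field; rewrite !gt_eqF.
have q20 : 0 <= q ^+ 2 by rewrite sqr_ge0.
rewrite mulr_ge0 ?subr_ge0 ?(ltW q_lt1) // addr_ge0 //.
  by rewrite subr_ge0 (le_trans z1).
by rewrite !mulr_ge0 ?subr_ge0 ?(ltW q_lt1) // ltW.
Qed.

(** From x + 1/x - y - 1/y = (1 - x/y)(1 - xy)/x: passing
    from p to p' increases 1 - xy, while 1 - x/y is at most 1 at p and equal to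
    1 - q^(m - p') at p'. *)
Lemma qcoord_beta m p p' : (p < p')%N -> (p' < m)%N ->
  (qcoord m - qcoord p) * (1 - q ^+ (m - p')) <= qcoord m - qcoord p'.
Proof.
move=> pp pm; rewrite !uv_sub ?qnode_neq0 //.
have x0 := qnode_gt0 m; have y0 := qnode_gt0 p; have y'0 := qnode_gt0 p'.
have yy : qnode p' <= qnode p.
  rewrite -(subnKC (ltnW pp)) qnodeD ler_piMl ?(ltW y0) // exprn_ile1 // ltW //.
have xy : qnode m <= qnode p.
  rewrite -(subnKC (ltnW (ltn_trans pp pm))) qnodeD ler_piMl ?(ltW y0) // exprn_ile1 // ltW //.
have -> : q ^+ (m - p') = qnode m / qnode p'.
  by rewrite -{2}(subnKC (ltnW pm)) qnodeD mulfK // gt_eqF.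
have xy' : qnode m <= qnode p'.
  rewrite -(subnKC (ltnW pm)) qnodeD ler_piMl ?(ltW y'0) // exprn_ile1 // ltW //.
have -> : (1 - qnode m / qnode p) * (1 - qnode m * qnode p) / qnode m * (1 - qnode m / qnode p')
  = (1 - qnode m / qnode p') / qnode m * ((1 - qnode m / qnode p) * (1 - qnode m * qnode p)) by ring.
have -> : (1 - qnode m / qnode p') * (1 - qnode m * qnode p') / qnode m
  = (1 - qnode m / qnode p') / qnode m * (1 - qnode m * qnode p') by ring.
have z1 := qnode_le1 m; have z2 := qnode_le1 p.
apply: ler_wpM2l.
  by rewrite divr_ge0 ?(ltW x0) // subr_ge0 ler_pdivrMr // mul1r.
apply: (@le_trans _ _ (1 - qnode m * qnode p)).
  rewrite ler_piMl //.
    by rewrite subr_ge0 mulr_ile1 // ltW.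
  by rewrite gerBl divr_ge0 // ltW.
by rewrite lerB // ler_wpM2l // ltW.
Qed.

Lemma entry_denom_incr n : entry_denom (qnode n) <= entry_denom (qnode n.+1).
Proof.
have z0 := qnode_gt0 n; have z1 := qnode_gt0 n.+1.
have zz : qnode n.+1 <= qnode n by rewrite qnodeS ler_piMl ?(ltW z0) ?(ltW q_lt1).
rewrite /entry_denom; case: G => //.
  by rewrite lerB ?ler_wsqrtr // lef_pV2 ?posrE ?sqrtr_gt0 // ler_wsqrtr.
by rewrite lerB // lef_pV2 ?posrE.
Qed.

Lemma entry_denom_ratio : exists2 A, 1 <= A & forall n, entry_denom (qnode n.+1) <= A * entry_denom (qnode n).
Proof.
have key (t x : R) : 0 < t < 1 -> 0 < x -> x * x <= t ->
    (t * x)^-1 - t * x <= (t * (1 - t))^-1 * (x^-1 - x).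
  move=> /andP[t0 t1] x0 xt.
  have tt : 0 < t * (1 - t) by rewrite mulr_gt0 // subr_gt0.
  rewrite [leRHS]mulrC ler_pdivlMr // -subr_ge0.
  have -> : x^-1 - x - ((t * x)^-1 - t * x) * (t * (1 - t))
    = (t - x * x + t ^+ 2 * (1 - t) * (x * x)) / x by field; rewrite !gt_eqF.
  rewrite divr_ge0 ?(ltW x0) // addr_ge0 ?subr_ge0 //.
  by rewrite !mulr_ge0 ?subr_ge0 ?sqr_ge0 // ltW.
have key1 (t : R) : 0 < t < 1 -> 1 <= (t * (1 - t))^-1.
  move=> /andP[t0 t1].
  rewrite invf_ge1 ?mulr_gt0 ?subr_gt0 //; nra.
have zle n : qnode n <= qnode 0.
  rewrite -[n]add0n qnodeD ler_piMl ?exprn_ile1 ?(ltW q_gt0) ?(ltW q_lt1) //.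
  exact/ltW/qnode_gt0.
rewrite /entry_denom; case E: G.
- have s01 : 0 < Num.sqrt q < 1 by rewrite sqrtr_gt0 q_gt0 -sqrtr1 ltr_sqrt.
  exists (Num.sqrt q * (1 - Num.sqrt q))^-1; first exact: key1.
  move=> n; rewrite qnodeS sqrtrM ?(ltW q_gt0) //; apply: key => //.
    by rewrite sqrtr_gt0 qnode_gt0.
  rewrite -expr2 sqr_sqrtr ?(ltW (qnode_gt0 n)) //.
  apply: le_trans (zle n) _.
  by rewrite /qnode E add0r /eps powR12_sqrt // ltW.
- exists (q * (1 - q))^-1; first by apply: key1; rewrite q_gt0.
  move=> n; rewrite qnodeS; apply: key; rewrite ?q_gt0 ?qnode_gt0 //.
  have : qnode n <= q by apply: le_trans (zle n) _; rewrite /qnode E add0r /eps powRr1 // ltW.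
  by apply: le_trans; rewrite ler_piMl ?qnode_le1 // ltW ?qnode_gt0.
- by exists 1 => // n; rewrite mulr1.
Qed.

(** Positivity of the infinite product of the 1 - q^n, with an explicit bound:
    1 - q^n >= exp(- q^(n-1) / (1 - q)). *)
Lemma prod_1Bq_ge (n : nat) :
  expR (- (1 - q) ^- 2) <= \prod_(i < n) (1 - q ^+ i.+1).
Proof.
have q1 : 0 < 1 - q by rewrite subr_gt0.
suff H : expR (- ((1 - q ^+ n) / (1 - q) ^+ 2)) <= \prod_(i < n) (1 - q ^+ i.+1).
  apply: le_trans H; rewrite ler_expR lerN2 ler_piMl ?invr_ge0 ?sqr_ge0 //.
  by rewrite gerBl exprn_ge0 // ltW.
elim: n => [|n IH]; first by rewrite big_ord0 expr0 subrr mul0r oppr0 expR0.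
rewrite big_ord_recr /=.
have -> : - ((1 - q ^+ n.+1) / (1 - q) ^+ 2)
   = - ((1 - q ^+ n) / (1 - q) ^+ 2) + - (q ^+ n / (1 - q)).
  by rewrite exprS; field; rewrite gt_eqF.
rewrite expRD ler_pM ?expR_ge0 // expRN.
have qn0 : 0 < q ^+ n by rewrite exprn_gt0.
have qn1 : q ^+ n <= 1 by rewrite exprn_ile1 ?(ltW q_gt0) ?(ltW q_lt1).
have d0 : 0 < 1 - q ^+ n.+1 by rewrite exprS; nra.
rewrite -[leRHS]invrK lef_pV2 ?posrE ?expR_gt0 ?invr_gt0 //.
apply: le_trans (expR_ge1Dx _).
have -> : (1 - q ^+ n.+1)^-1 = 1 + q ^+ n.+1 / (1 - q ^+ n.+1).
  by field; rewrite gt_eqF.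
rewrite lerD2l ler_pM ?invr_ge0 ?(ltW d0) ?exprn_ge0 ?(ltW q_gt0) //.
  by rewrite exprS ler_piMl ?(ltW q_lt1) // ltW.
by rewrite lef_pV2 ?posrE // lerB // exprS ler_piMr // ltW.
Qed.
End QPoint.

(** * Signatures, strict sequences and characters at q-points *)

(** The strictly decreasing sequence lambda_i + N - i attached to a signature,
    indexed from 0. *)
Definition shifted (N : nat) (mu : GT N) (i : nat) : nat :=
  (part mu i.+1 + (N - i.+1))%N.

Lemma part_sorted (N : nat) (mu : GT N) (i : nat) : (i.+1 < N)%N ->
  (part mu i.+2 <= part mu i.+1)%N.
Proof.
move=> iN; rewrite /part /=.
by have /(sortedP 0%N) := valP mu; apply; rewrite size_tuple.
Qed.

Lemma shifted_dec (N : nat) (mu : GT N) (i : nat) : (i.+1 < N)%N ->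
  (shifted mu i.+1 < shifted mu i)%N.
Proof. by move=> iN; have := part_sorted mu iN; rewrite /shifted; lia. Qed.

Lemma shifted_lt (N : nat) (mu : GT N) (i j : nat) : (i < j < N)%N ->
  (shifted mu j < shifted mu i)%N.
Proof.
elim: j => // j IH /andP[]; rewrite ltnS leq_eqVlt => /predU1P[-> jN|ij jN].
  exact: shifted_dec.
by apply: ltn_trans (shifted_dec _ jN) (IH _); rewrite ij ltnW.
Qed.

Lemma shifted_inj (N : nat) (mu mu' : GT N) :
  (forall i : 'I_N, shifted mu i = shifted mu' i) -> mu = mu'.
Proof.
move=> eq_sh; apply: val_inj; apply: eq_from_tnth => i.
have := eq_sh i; rewrite /shifted /part /= => /addIn.
by rewrite -!tnth_nth.
Qed.

(** The inverse of [shifted]; arguments that are not strictly decreasing may be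
    sent to the zero signature, which only affects weights equal to 0. *)
Definition unshift_sig (N K : nat) (h : {ffun 'I_N -> 'I_K}) : GT N :=
  insubd (exist _ (nseq_tuple N 0%N) (GT0_subproof N)
            : {l : N.-tuple nat | sorted geq l})
    [tuple (h i - (N - i.+1))%N | i < N].

Lemma unshift_sigK (N K : nat) (h : {ffun 'I_N -> 'I_K}) :
  (forall i j : 'I_N, (i < j)%N -> (h j < h i)%N) ->
  forall i : 'I_N, shifted (unshift_sig h) i = h i.
Proof.
move=> h_dec.
have h_dec1 (i j : 'I_N) : j = i.+1 :> nat -> (h j < h i)%N.
  by move=> ji; apply: h_dec; rewrite ji.
have h_ge d (i : 'I_N) : (i + d.+1 = N)%N -> (d <= h i)%N.
  elim: d i => // d IH i iN.
  have i1 : (i.+1 < N)%N by lia.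
  have /IH h1 : (Ordinal i1 + d.+1 = N)%N by rewrite /=; lia.
  exact: leq_ltn_trans h1 (h_dec1 i (Ordinal i1) erefl).
have srt : sorted geq [tuple (h i - (N - i.+1))%N | i < N].
  apply/(sortedP 0%N) => i; rewrite size_tuple => iN.
  have -> : nth 0%N [tuple (h i - (N - i.+1))%N | i < N] i.+1
     = (h (Ordinal iN) - (N - i.+2))%N.
    by rewrite -[i.+1]/(nat_of_ord (Ordinal iN)) -tnth_nth tnth_mktuple.
  have -> : nth 0%N [tuple (h i - (N - i.+1))%N | i < N] i
     = (h (Ordinal (ltnW iN)) - (N - i.+1))%N.
    by rewrite -[in LHS]/(nat_of_ord (Ordinal (ltnW iN))) -tnth_nth tnth_mktuple.
  have := h_dec1 (Ordinal (ltnW iN)) (Ordinal iN) erefl.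
  rewrite /geq /=; lia.
move=> i; rewrite /shifted /part /unshift_sig insubdK // -tnth_nth tnth_mktuple subnK //.
by apply: h_ge; have := ltn_ord i; lia.
Qed.

Lemma fsbig_image_law (R : pzRingType) (T : choiceType) (I : finType) (u : I -> T)
    (w : I -> R) (g : T -> R) :
  finite_set [set m | \sum_(i | u i == m) w i != 0] /\
  \sum_(m \in [set: T]) (\sum_(i | u i == m) w i) * g m = \sum_i w i * g (u i).
Proof.
pose A := [fset u i | i in I]%fset.
have A0 m : m \notin A -> \sum_(i | u i == m) w i = 0.
  move=> mA; apply: big_pred0 => i; apply: contraNF mA => /eqP <-.
  by apply/imfsetP; exists i.
split.
  apply: (sub_finite_set (B := [set` A])); last exact: finite_fset.
  by move=> m /=; apply: contraR => /A0 ->.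
rewrite (fsbigTE A); last by move=> m /A0 ->; rewrite mul0r.
under eq_bigr do rewrite mulr_suml big_mkcond.
rewrite exchange_big; apply: eq_bigr => i _ /=.
rewrite -big_mkcond /=.
have uiA : u i \in A by apply/imfsetP; exists i.
rewrite (big_rem (u i)) //= eqxx big_seq_cond big1 ?addr0 // => m /andP[mA /eqP um].
by move: mA; rewrite -um mem_rem_uniqF ?fset_uniq.
Qed.

Section DetQ.
Variables (R : realType) (q : R) (G : series_type).
Hypothesis q_gt0 : 0 < q.
Hypothesis q_lt1 : q < 1.
Local Notation qnode := (qnode q G).
Local Notation qcoord := (qcoord q G).

Lemma qcoord_lt m n : (m < n)%N -> qcoord m < qcoord n.
Proof. exact: (homo_ltn lt_trans (qcoord_incr G q_gt0 q_lt1)). Qed.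

Lemma lead_jpoly_neq0 n : (jpoly R G n)`_n != 0.
Proof. by rewrite lead_jpoly; case: G; case: n => [|n]; rewrite ?oner_neq0 ?pnatr_eq0. Qed.

Definition detq_const (N : nat) : R :=
  \prod_(j < N) (entry_denom G (qnode j))^-1 * \prod_(j < N) (jpoly R G j)`_j *
  \prod_(i < N) \prod_(j < N | (i < j)%N) -1.

Lemma detq_const_neq0 N : detq_const N != 0.
Proof.
rewrite /detq_const !mulf_neq0 //.
- by apply/prodf_neq0 => i _; rewrite invr_neq0 // gt_eqF // entry_denom_gt0.
- by apply/prodf_neq0 => i _; exact: lead_jpoly_neq0.
- by apply/prodf_neq0 => i _; apply/prodf_neq0 => j _; rewrite oppr_eq0 oner_neq0.
Qed.

(** The product formula for the characters at q-points, up to the constant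
    [detq_const], from [jpoly_dual] and the Vandermonde determinant. *)
Lemma det_qpoint (N : nat) (g : 'I_N -> nat) :
  \det (\matrix_(i < N, j < N) (jpoly R G (g i)).[qcoord j])
  = detq_const N * (\prod_i entry_denom G (qnode (g i)) *
      \prod_(i < N) \prod_(j < N | (i < j)%N) (qcoord (g i) - qcoord (g j))).
Proof.
transitivity (\det (\matrix_(i < N, j < N)
    (entry_denom G (qnode (g i)) * ((jpoly R G j).[qcoord (g i)] * (entry_denom G (qnode j))^-1)))).
  congr (\det _); apply/matrixP => i j; rewrite !mxE mulrA -jpoly_dual //.
  by rewrite mulfK // gt_eqF // entry_denom_gt0.
rewrite (det_scale_rows (fun i => entry_denom G (qnode (g i)))
  (fun i j => (jpoly R G j).[qcoord (g i)] * (entry_denom G (qnode j))^-1)).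
rewrite (det_scale_cols (fun j : 'I_N => (entry_denom G (qnode j))^-1)
  (fun i j => (jpoly R G j).[qcoord (g i)])).
rewrite (det_horner_Vandermonde (p := jpoly R G) (fun i => qcoord (g i)));
  last exact: size_jpoly.
have -> : \prod_(i < N) \prod_(j < N | (i < j)%N) (qcoord (g j) - qcoord (g i))
  = \prod_(i < N) \prod_(j < N | (i < j)%N) -1 *
    \prod_(i < N) \prod_(j < N | (i < j)%N) (qcoord (g i) - qcoord (g j)).
  rewrite -big_split; apply: eq_bigr => i _ /=.
  by rewrite -big_split; apply: eq_bigr => j _ /=; rewrite mulN1r opprB.
by rewrite /detq_const; ring.
Qed.

Lemma VsE (N : nat) (z : 'I_N -> R) : Vs z =
  \prod_(i < N) \prod_(j < N | (i < j)%N) (z i + (z i)^-1 - (z j + (z j)^-1)).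
Proof.
by apply: eq_bigr => i _; apply: eq_bigr => j _; rewrite opprD addrA.
Qed.

Lemma Vs_qpoint_neq0 N : Vs (@qpoint R q G N) != 0.
Proof.
rewrite VsE; apply/prodf_neq0 => i _; apply/prodf_neq0 => j ij.
by rewrite lt_eqF // subr_lt0; apply: qcoord_lt.
Qed.

(** The points where the determinant entry agrees with the polynomial; for
    type D this includes 1, which occurs in the q-points. *)
Definition admissible (z : R) := 0 < z /\ (z != 1 \/ G = typeD).

Lemma admissible_qnode n : admissible (qnode n).
Proof.
split; first exact: qnode_gt0.
have [GD|GD] : G = typeD \/ G <> typeD by case: G; [right|right|left].
  by right.
by left; rewrite lt_eqF // qnode_lt1 //; right.
Qed.

Lemma chiE (N : nat) (mu : GT N) (x : 'I_N -> R) :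
  (forall j, admissible (x j)) ->
  chi G mu x = (Vs x)^-1 *
    \det (\matrix_(i < N, j < N) (jpoly R G (shifted mu i)).[x j + (x j)^-1]).
Proof.
move=> adm; congr (_ * \det _); apply/matrixP => i j; rewrite !mxE.
by have [x0 x1] := adm j; rewrite char_entryE.
Qed.

Lemma chi_qpoint_neq0 N (mu : GT N) : chi G mu (@qpoint R q G N) != 0.
Proof.
rewrite chiE; last by move=> j; apply: admissible_qnode.
rewrite mulf_neq0 ?invr_neq0 ?Vs_qpoint_neq0 //.
rewrite (det_qpoint (fun i : 'I_N => shifted mu i)) mulf_neq0 ?detq_const_neq0 //.
rewrite mulf_neq0 //; first by apply/prodf_neq0 => i _; rewrite gt_eqF // entry_denom_gt0.
apply/prodf_neq0 => i _; apply/prodf_neq0 => j ij.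
by rewrite gt_eqF // subr_gt0 qcoord_lt // shifted_lt // ij /=.
Qed.

Lemma snoc_widen N (x : 'I_N -> R) a i :
  snoc x a (widen_ord (leqnSn N) i) = x i.
Proof.
have -> : widen_ord (leqnSn N) i = lift ord_max i.
  by apply: val_inj; rewrite /= /bump leqNgt ltn_ord.
by rewrite /snoc liftK.
Qed.

Lemma snoc_max N (x : 'I_N -> R) a : snoc x a ord_max = a.
Proof. by rewrite /snoc unlift_none. Qed.

Lemma Vs_snoc N (x : 'I_N -> R) a : Vs (snoc x a) =
  Vs x * \prod_(j < N) (x j + (x j)^-1 - (a + a^-1)).
Proof.
rewrite !VsE big_ord_recr /= [X in _ * X]big_pred0 ?mulr1; last first.
  by move=> j; apply/negbTE; rewrite -leqNgt -ltnS.
rewrite -big_split; apply: eq_bigr => i _ /=.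
rewrite big_mkcond big_ord_recr -big_mkcond /= ltn_ord !snoc_widen snoc_max.
by congr (_ * _); apply: eq_bigr => j _; rewrite snoc_widen.
Qed.

Lemma snoc_qpoint N : snoc (@qpoint R q G N) (q `^ (N%:R + eps R G)) = @qpoint R q G N.+1.
Proof.
apply/funext => i; rewrite /snoc; case: unliftP => [j ->|->] //=.
by rewrite /qpoint lift_max.
Qed.
End DetQ.

(** * The branching coefficients *)

Section Branching.
Variables (R : realType) (q : R) (G : series_type).
Hypothesis q_gt0 : 0 < q.
Hypothesis q_lt1 : q < 1.
Variables (N K : nat) (lam : GT N.+1).
Hypothesis lamK : (shifted lam 0 < K)%N.
Local Notation qnode := (qnode q G).
Local Notation qcoord := (qcoord q G).
Local Notation a0 := (q `^ (N%:R + eps R G)).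
Local Notation conf := ({ffun 'I_N -> 'I_K} * {ffun 'I_N -> 'I_K})%type.

Lemma qcoord_ge2 n : 2 <= qcoord n. Proof. exact/uv_ge2/qnode_gt0. Qed.

Lemma jpoly_qcoord_neq0 m n : (jpoly R G n).[qcoord m] != 0.
Proof. by rewrite gt_eqF // jpoly_gt0 // qcoord_ge2. Qed.

(** [branch_det] for characters. It applies to generic points and also to the
    q-point, which yields the normalizing constant of the kernel. *)
Lemma chi_snoc (x : 'I_N -> R) : (forall j, admissible G (x j)) ->
  \prod_(j < N) (x j + (x j)^-1 - qcoord N) != 0 ->
  chi G lam (snoc x a0)
  = \prod_(i < N.+1) (jpoly R G (shifted lam i)).[qcoord N] * (Vs x)^-1 *
    \sum_(om : conf) branch_weight G (qcoord N) (shifted lam) om.1 om.2 *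
      \det (\matrix_(i < N, j < N) (jpoly R G (om.2 i)).[x j + (x j)^-1]).
Proof.
move=> adm px; rewrite chiE; last first.
  move=> j; rewrite /snoc; case: (unlift ord_max j) => [i|] /=; first exact: adm.
  exact: admissible_qnode.
rewrite Vs_snoc -[a0 + _]/(qcoord N).
have -> : \matrix_(i < N.+1, j < N.+1)
     (jpoly R G (shifted lam i)).[snoc x a0 j + (snoc x a0 j)^-1]
   = \matrix_(i, j) (jpoly R G (shifted lam i)).[
       oapp (fun j => x j + (x j)^-1) (qcoord N) (unlift ord_max j)].
  by apply/matrixP => i j; rewrite !mxE /snoc; case: unlift.
rewrite (@branch_det _ _ _ (jpoly_qcoord_neq0 N) N K (shifted lam)) //; last first.
  by move=> i iN; apply/ltnW/shifted_dec.
rewrite pair_bigA /= invfM.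
have alg (V D F s : R) : D != 0 -> V * D^-1 * (F * D * s) = F * V * s.
  by move=> D0; field.
exact: alg.
Qed.

Definition qweight (om : conf) : R :=
  conf_weight (fun n => (jpoly R G n).[qcoord N]) (jweight R G) (fun n => entry_denom G (qnode n)) qcoord (shifted lam) om.

Lemma qweight_branch (om : conf) :
  branch_weight G (qcoord N) (shifted lam) om.1 om.2 *
    \det (\matrix_(i < N, j < N) (jpoly R G (om.2 i)).[qcoord j])
  = detq_const q G N * qweight om.
Proof.
rewrite (det_qpoint G q_gt0 q_lt1 (fun i => om.2 i : nat)) /branch_weight /qweight /conf_weight /Vdiff.
case: ifP => _; last by rewrite mul0r mulr0.
by rewrite /top_weight /low_weight mulrCA.
Qed.

Lemma qweight_ge0 om : 0 <= qweight om.
Proof.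
apply: conf_weight_ge0 => n.
- exact/jpoly_gt0/qcoord_ge2.
- exact: jweight_gt0.
- exact: entry_denom_gt0.
- exact: qcoord_incr.
Qed.

Lemma sum_qweight_gt0 : 0 < \sum_(om : conf) qweight om.
Proof.
have sK (i : 'I_N) : ((shifted lam i.+1).+1 < K)%N.
  apply: leq_ltn_trans lamK; apply: shifted_lt => //=; exact: ltn_ord.
(* The most likely configuration: nu_i = l_(i+1) + 1 and h_i = l_(i+1). *)
pose om : conf := ([ffun i => Ordinal (sK i)], [ffun i => Ordinal (ltnW (sK i))]).
have itl : interlace_top (shifted lam) om.1 && interlace_low om.1 om.2.
  apply/andP; split; apply/forallP => i; rewrite !ffunE /= ltnSn ?andbT.
    by apply: shifted_dec; rewrite ltnS ltn_ord.
  case: (ltnP i.+1 N) => iN; last by rewrite ext0_ge.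
  by rewrite -[i.+1]/(nat_of_ord (Ordinal iN)) ext0_ord ffunE; apply: shifted_dec.
rewrite (bigD1 om) //=; apply: ltr_wpDr.
  by apply: sumr_ge0 => om' _; apply: qweight_ge0.
rewrite /qweight /conf_weight itl; have f0 n := jpoly_gt0 G n (qcoord_ge2 N).
rewrite !mulr_gt0 //; try (apply: prodr_gt0 => i _).
- by rewrite invr_gt0 mulr_gt0.
- by rewrite mulr_gt0 ?jweight_gt0.
- exact: entry_denom_gt0.
- apply: prodr_gt0 => j ij; rewrite subr_gt0; apply: qcoord_lt => //.
  exact: (interlace_low_decr itl).
Qed.

Definition branch_law (om : conf) : R := qweight om / \sum_(om : conf) qweight om.

(** Both sides are sums over pairs (nu, h) with the same branching weights; the
    product formula turns the ratio of normalizations into the total weight. *)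
Lemma branch_law_branching :
  is_branching q G lam (fun mu => \sum_(om : conf | unshift_sig om.2 == mu) branch_law om).
Proof.
split; first exact: (fsbig_image_law _ _ (fun=> 0)).1.
move=> x [gx gV]; rewrite (fsbig_image_law _ _ (fun m => chi G m x / chi G m _)).2.
have adm j : admissible G (x j).
  by have [] := gx (widen_ord (leqnSn N) j); rewrite snoc_widen; split => //; left.
move: gV; rewrite Vs_snoc mulf_eq0 negb_or => /andP[V0 D0].
rewrite chi_snoc // -snoc_qpoint // chi_snoc; first last.
- apply/prodf_neq0 => j _; rewrite lt_eqF // subr_lt0.
  by apply: qcoord_lt => //; exact: ltn_ord.
- by move=> j; apply: admissible_qnode.
set F := \prod_(i < N.+1) _.
have F0 : F != 0 by apply/prodf_neq0 => i _; apply: jpoly_qcoord_neq0.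
have Vq0 := Vs_qpoint_neq0 G q_gt0 q_lt1 N.
under [X in _ / (_ * X)]eq_bigr do rewrite qweight_branch.
rewrite -mulr_sumr; set Z := \sum_(om : conf) qweight om.
have Z0 : Z != 0 by rewrite gt_eqF // sum_qweight_gt0.
have c0 := detq_const_neq0 G q_gt0 q_lt1 N.
rewrite mulr_sumr mulr_suml; apply: eq_bigr => om _.
rewrite /branch_law -/Z; case itl: (interlace_top (shifted lam) om.1 && interlace_low om.1 om.2); last first.
  by rewrite /branch_weight /qweight /conf_weight itl !(mul0r, mulr0).
have shE (i : 'I_N) : shifted (unshift_sig om.2) i = om.2 i.
  by apply: unshift_sigK => a b ab; apply: (interlace_low_decr itl).
have unshE (u : 'I_N -> R) :
  \matrix_(i < N, j < N) (jpoly R G (shifted (unshift_sig om.2) i)).[u j]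
  = \matrix_(i < N, j < N) (jpoly R G (om.2 i)).[u j].
  by apply/matrixP => i j; rewrite !mxE shE.
have := chi_qpoint_neq0 G q_gt0 q_lt1 (unshift_sig om.2).
rewrite !chiE //; last by move=> j; apply: admissible_qnode.
rewrite (unshE (fun j => x j + (x j)^-1)) (unshE (fun j : 'I_N => qcoord j)).
have := qweight_branch om; set b := branch_weight _ _ _ _ _; set dq := \det _; set dx := \det _.
move=> Wb; rewrite mulf_eq0 negb_or => /andP[_ dq0].
have -> : qweight om = b * dq / detq_const q G N by rewrite Wb; field.
by field; rewrite F0 V0 Vq0 Z0 c0 dq0.
Qed.
End Branching.

Section Uniqueness.
Variables (R : realType) (q : R) (G : series_type).
Hypothesis q_gt0 : 0 < q.
Hypothesis q_lt1 : q < 1.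

(** If the two sequences have different sets of values, then some row is zero;
    if the sets agree, so do the sequences, both being decreasing. *)
Lemma det_shifted_delta (N : nat) (mu mu' : GT N) :
  \det (\matrix_(i < N, j < N) (shifted mu i == shifted mu' j)%:R) = (mu == mu')%:R :> R.
Proof.
case: eqP => [->|neq].
  rewrite -[RHS](det1 _ N); congr (\det _); apply/matrixP => i j; rewrite !mxE.
  congr ((nat_of_bool _)%:R); apply/eqP/eqP => [|->//] eq_ij.
  apply: val_inj; case: (ltngtP i j) => // ij.
    by have := @shifted_lt _ mu' i j; rewrite ij ltn_ord eq_ij ltnn => /(_ isT).
  by have := @shifted_lt _ mu' j i; rewrite ij ltn_ord eq_ij ltnn => /(_ isT).
have [/existsP[i /forallP Ni]|] :=
  boolP [exists i : 'I_N, [forall j : 'I_N, shifted mu i != shifted mu' j]].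
  rewrite (expand_det_row _ i) big1 // => j _.
  by rewrite mxE (negPf (Ni j)) mul0r.
rewrite negb_exists => /forallP sub; case: neq.
pose s (nu : GT N) := [seq shifted nu i | i <- iota 0 N].
have s_sorted nu : sorted gtn (s nu).
  apply/(sortedP 0%N) => i; rewrite size_map size_iota => iN.
  by rewrite !(nth_map 0%N) ?size_iota ?nth_iota ?(ltnW iN) //; exact: shifted_dec.
have s_uniq nu : uniq (s nu).
  apply: sorted_uniq (s_sorted nu).
    by move=> a b c ab bc; apply: ltn_trans bc ab.
  by move=> a; rewrite /gtn /= ltnn.
have s_sub : {subset s mu <= s mu'}.
  move=> n /mapP[i]; rewrite mem_iota add0n => /andP[_ iN] ->.
  have := sub (Ordinal iN); rewrite negb_forall => /existsP[j].
  rewrite negbK => /eqP /= ->; apply/mapP; exists (nat_of_ord j) => //.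
  by rewrite mem_iota add0n ltn_ord.
have [_ s_eq] := uniq_min_size (s_uniq mu) s_sub (eq_leq (esym (etrans (size_map _ _) (esym (size_map _ _))))).
have s_eqE : s mu = s mu'.
  apply: (irr_sorted_eq (leT := gtn)) => //.
    by move=> a b c ab bc; apply: ltn_trans bc ab.
  by move=> a; rewrite /gtn /= ltnn.
apply: shifted_inj => i; have := congr1 (nth 0%N ^~ i) s_eqE.
by rewrite /= !(nth_map 0%N) ?size_iota ?nth_iota // add0n.
Qed.

(** Linear independence of the characters on generic points. The points a/(p+2)
    are generic together with a, and the matrix of values of the polynomials at
    K of them is invertible. Summing over each variable against the rows of the
    inverse matrix extracts the coefficient of a given signature. Tuples of
    points with a repetition are harmless, since there all determinants vanish. *)
Lemma branching_unique (N : nat) (lam : GT N.+1) (c1 c2 : GT N -> R) :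
  (0 < N)%N -> is_branching q G lam c1 -> is_branching q G lam c2 -> c1 = c2.
Proof.
move=> N0 [fin1 H1] [fin2 H2]; apply/funext => mu0.
pose A := (fset_set [set m | c1 m != 0] `|` (fset_set [set m | c2 m != 0] `|` [fset mu0]))%fset.
pose d m := (c1 m - c2 m) / chi G m (@qpoint R q G N).
have inA c : finite_set [set m | c m != 0] -> {subset fset_set [set m | c m != 0] <= A} ->
    forall x, \sum_(m \in [set: GT N]) c m * (chi G m x / chi G m (@qpoint R q G N))
      = \sum_(m <- A) c m * (chi G m x / chi G m (@qpoint R q G N)).
  move=> fin sub x; apply: fsbigTE => m mA.
  suff -> : c m = 0 by rewrite mul0r.
  by apply/eqP; apply: contraNT mA => cm; apply: sub; rewrite in_fset_set ?inE.
have a_gt0 : 0 < qnode q G N by exact: qnode_gt0.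
have a_lt1 : qnode q G N < 1 by apply: qnode_lt1 => //; left.
have dchi x : generic (snoc x (qnode q G N)) -> \sum_(m <- A) d m * chi G m x = 0.
  move=> gx; have := H1 x gx; rewrite (H2 x gx) !inA //; first last.
  - by move=> m mA; rewrite /A !in_fsetU mA ?orbT.
  - by move=> m mA; rewrite /A !in_fsetU mA ?orbT.
  move=> /eqP; rewrite eq_sym -subr_eq0 -sumrB => /eqP cc; rewrite -[RHS]cc.
  by apply: eq_bigr => m _; rewrite /d mulrBl mulrBl; ring.
pose K := (\max_(m <- A) (part m 1 + N)).+1%N.
have shK m (i : 'I_N) : m \in A -> (shifted m i < K)%N.
  move=> mA; rewrite ltnS; apply: (@leq_trans (part m 1 + N)).
    suff : (shifted m i <= shifted m 0)%N by rewrite /shifted; lia.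
    by case: (posnP i) => [->//|i0]; apply/ltnW/shifted_lt; rewrite i0 ltn_ord.
  exact: (leq_bigmax_seq (F := fun m : GT N => (part m 1 + N)%N)).
(* Distinct points of the interval (0, a), which lies in (0, 1). *)
pose t (p : nat) : R := qnode q G N / p.+2%:R.
have t_gt0 p : 0 < t p by rewrite divr_gt0.
have t_lt p p' : (p < p')%N -> t p' < t p.
  by move=> pp; rewrite ltr_pM2l // ltf_pV2 ?posrE // ltr_nat.
have t_lta p : t p < qnode q G N.
  by rewrite ltr_pdivrMr // ltr_pMr // ltr1n.
pose u p := t p + (t p)^-1.
have uv_lt (x y : R) : 0 < x -> x < y -> y < 1 -> y + y^-1 < x + x^-1.
  move=> x0 xy y1; have y0 := lt_trans x0 xy; have x1 := lt_trans xy y1.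
  rewrite -subr_gt0 uv_sub; [|by rewrite gt_eqF..].
  rewrite divr_gt0 // mulr_gt0 // subr_gt0; first by rewrite ltr_pdivrMr ?mul1r.
  by rewrite mulr_ilt1 ?ltW.
have t_lt1 p : t p < 1 by apply: lt_trans a_lt1.
have u_lt p p' : (p < p')%N -> u p < u p' by move=> pp; apply: uv_lt => //; exact: t_lt.
have u_neq p p' : p != p' -> u p != u p'.
  by case: ltngtP => // pp _; [rewrite lt_eqF|rewrite gt_eqF] => //; apply: u_lt.
pose F : 'M[R]_K := \matrix_(p, m) (jpoly R G m).[u p].
have Fu : F \in unitmx.
  rewrite unitmxE unitfE (det_horner_Vandermonde (p := jpoly R G) (fun p => u p));
    last exact: size_jpoly.
  rewrite mulf_neq0 //; first by apply/prodf_neq0 => j _; exact: lead_jpoly_neq0.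
  by apply/prodf_neq0 => i _; apply/prodf_neq0 => j ij; rewrite gt_eqF // subr_gt0 u_lt.
pose Fi := invmx F.
have FiF (a b : 'I_K) : \sum_p Fi a p * (jpoly R G b).[u p] = (a == b)%:R.
  have := congr1 (fun M : 'M[R]_K => M a b) (mulVmx Fu); rewrite !mxE => <-.
  by apply: eq_bigr => p _; rewrite !mxE.
have Phi0 (p : {ffun 'I_N -> 'I_K}) :
  \sum_(m <- A) d m * \det (\matrix_(i < N, j < N) (jpoly R G (shifted m i)).[u (p j)]) = 0.
  have [/injectiveP pI|/injectivePn[i [j ij pij]]] := boolP (injectiveb p).
    have gx : generic (snoc (fun j => t (p j)) (qnode q G N)).
      split.
        move=> i; rewrite /snoc; case: unlift => [j|] /=; first by rewrite lt_eqF.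
        by rewrite lt_eqF.
      rewrite Vs_snoc mulf_neq0 //.
        rewrite VsE; apply/prodf_neq0 => i _; apply/prodf_neq0 => j ij.
        rewrite subr_eq0; apply: u_neq; apply: contraTneq ij => /val_inj/pI ->.
        by rewrite ltnn.
      by apply/prodf_neq0 => j _; rewrite gt_eqF // subr_gt0; apply: uv_lt.
    have := dchi _ gx; move: gx => [_]; rewrite Vs_snoc mulf_eq0 negb_or => /andP[V0 _].
    have -> : \sum_(m <- A) d m * chi G m (fun j => t (p j))
      = (Vs (fun j => t (p j)))^-1 * \sum_(m <- A) d m *
         \det (\matrix_(i < N, j < N) (jpoly R G (shifted m i)).[u (p j)]).
      rewrite mulr_sumr; apply: eq_bigr => m _.
      rewrite (@chiE _ G _ m (fun j => t (p j))); first by rewrite [LHS]mulrCA.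
      by move=> j; split => //; left; rewrite lt_eqF.
    by move=> /eqP; rewrite mulf_eq0 invr_eq0 (negPf V0) => /eqP.
  rewrite big1 // => m _.
  rewrite -det_tr (determinant_alternate ij) ?mulr0 // => k.
  by rewrite !mxE pij.
have mu0A : mu0 \in A by rewrite /A !in_fsetU in_fset1 eqxx !orbT.
pose m0 (i : 'I_N) : 'I_K := Ordinal (shK mu0 i mu0A).
have : \sum_(p : {ffun 'I_N -> 'I_K})
   \prod_(j < N) Fi (m0 j) (p j) *
   \sum_(m <- A) d m * \det (\matrix_(i < N, j < N) (jpoly R G (shifted m i)).[u (p j)]) = 0.
  by rewrite big1 // => p _; rewrite Phi0 mulr0.
have -> : \sum_(p : {ffun 'I_N -> 'I_K})
   \prod_(j < N) Fi (m0 j) (p j) *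
   \sum_(m <- A) d m * \det (\matrix_(i < N, j < N) (jpoly R G (shifted m i)).[u (p j)])
   = \sum_(m <- A) d m * (m == mu0)%:R.
  under eq_bigr do rewrite mulr_sumr.
  rewrite exchange_big /= !big_seq; apply: eq_bigr => m mA.
  rewrite -det_shifted_delta -det_tr.
  under eq_bigr do rewrite mulrCA.
  rewrite -mulr_sumr; congr (_ * _).
  transitivity (\sum_(p : {ffun 'I_N -> 'I_K})
    \prod_(j < N) Fi (m0 j) (p j) *
      \det (\matrix_(i < N, j < N) (jpoly R G (shifted m j)).[u (p i)])).
    apply: eq_bigr => p _; rewrite -[in LHS]det_tr; congr (_ * \det _).
    by apply/matrixP => i j; rewrite !mxE.
  rewrite -(det_multilinear (fun j k => Fi (m0 j) k)
    (fun k j => (jpoly R G (shifted m j)).[u k])).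
  congr (\det _); apply/matrixP => i j; rewrite !mxE.
  by rewrite (FiF _ (Ordinal (shK m j mA))) -val_eqE /= eq_sym.
rewrite (big_rem mu0) //=.
rewrite eqxx mulr1 big_seq_cond big1 ?addr0; last first.
  move=> m /andP[mA _]; case: eqP => [mm|_]; last by rewrite mulr0.
  by move: mA; rewrite mm mem_rem_uniqF ?fset_uniq.
move=> /eqP; rewrite /d mulf_eq0 invr_eq0 (negPf (chi_qpoint_neq0 G q_gt0 q_lt1 _)) orbF.
by rewrite subr_eq0 => /eqP.
Qed.
End Uniqueness.

Section Lambda1.
Variables (R : realType) (q : R) (G : series_type).
Hypothesis q_gt0 : 0 < q.
Hypothesis q_lt1 : q < 1.

Lemma Lambda1E (N K : nat) (lam : GT N.+1) : (0 < N)%N -> (shifted lam 0 < K)%N ->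
  Lambda1 q G lam =
  fun mu => \sum_(om : {ffun 'I_N -> 'I_K} * {ffun 'I_N -> 'I_K} | unshift_sig om.2 == mu)
     branch_law q G lam om.
Proof.
move=> N0 lamK; have br := branch_law_branching G q_gt0 q_lt1 lamK.
by apply: xget_unique => // c bc; apply: (branching_unique q_gt0 q_lt1 N0 bc br).
Qed.
End Lambda1.

(** * One step of the chain keeps the k-th lowest part *)

Section OneStep.
Variables (R : realType) (q : R) (G : series_type).
Hypothesis q_gt0 : 0 < q.
Hypothesis q_lt1 : q < 1.

Lemma expr_small (e : R) : 0 < e -> exists n, q ^+ n <= e.
Proof.
move=> e0; have : q ^+ n @[n --> \oo] --> (0 : R).
  by apply: cvg_expr; rewrite ger0_norm // ltW.
move=> /cvgrPdist_le /(_ e e0) [n _ /(_ n (leqnn _))] /=.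
rewrite sub0r normrN ger0_norm ?exprn_ge0 ?(ltW q_gt0) // => qn.
by exists n.
Qed.

Definition is_image_law (T : choiceType) (p : T -> R) (I : finType) (w : I -> R) (u : I -> T) :=
  [/\ forall i, 0 <= w i, \sum_i w i = 1 & p = fun t => \sum_(i | u i == t) w i].

(** The weight bounds of the previous parts, at the site i0 = N - k: here tau is
    at most 2 q^N while A^k does not depend on N, so the probability that the
    k-th lowest part changes is O(q^N), uniformly in the starting signature. *)
Lemma one_step_stability (k : nat) : (0 < k)%N -> exists C N0, 0 <= C /\
  forall N (lam : GT N.+1), (N0 <= N)%N ->
  exists (I : finType) (w : I -> R) (u : I -> GT N),
    is_image_law (Lambda1 q G lam) w u /\
    \sum_(i | part (u i) (N.+1 - k) != part lam (N.+2 - k)) w i <= C * q ^+ N.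
Proof.
move=> k0; have [A1 A1_ge1 A1P] := entry_denom_ratio G q_gt0 q_lt1.
pose A2 : R := 1 + (q * (1 - q))^-1.
have A2_ge1 : 1 <= A2 by rewrite lerDl invr_ge0 mulr_ge0 ?subr_ge0 // ltW.
(* One constant for both growth rates, of the q-coordinates and of the
   denominators. *)
pose A := A1 * A2.
have A_ge1 : 1 <= A by rewrite mulr_ege1.
have A_gt0 : 0 < A by apply: lt_le_trans A_ge1.
pose c := expR (- (1 - q) ^- 2); have c0 : 0 < c by exact: expR_gt0.
have Ak0 : 0 < A ^+ k by rewrite exprn_gt0.
have [n0 n0P] : exists n, q ^+ n <= 2^-1 / (2 * A ^+ k).
  by apply: expr_small; rewrite divr_gt0 ?mulr_gt0.
exists (32 * c^-1 * A ^+ k), (maxn n0 k); split.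
  by rewrite !mulr_ge0 ?invr_ge0 // ltW.
move=> N lam; rewrite geq_max => /andP[n0N kN].
have N0 : (0 < N)%N by apply: leq_trans kN.
have i0N : (N - k < N)%N by rewrite ltn_subrL k0.
pose i0 := Ordinal i0N.
pose K := (shifted lam 0).+1.
have lamK : (shifted lam 0 < K)%N by [].
have sK : ((shifted lam i0.+1).+1 < K)%N by rewrite ltnS; apply: shifted_lt => /=; rewrite ltnS.
pose P1 := Ordinal sK; pose P0 := Ordinal (ltnW sK).
exists ({ffun 'I_N -> 'I_K} * {ffun 'I_N -> 'I_K})%type, (branch_law q G lam),
  (fun om => unshift_sig om.2).
have Z0 := sum_qweight_gt0 G q_gt0 q_lt1 lamK.
have W0 om := qweight_ge0 G q_gt0 q_lt1 lam om.
split.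
  split; first by move=> om; rewrite /branch_law divr_ge0 ?W0 ?(ltW Z0).
    by rewrite /branch_law -mulr_suml divff // gt_eqF.
  exact: Lambda1E.
have XN2 := qcoord_ge2 G q_gt0 N.
have X0 : 0 < qcoord q G N by apply: lt_le_trans XN2.
pose tau := 2 / qcoord q G N.
have tau0 : 0 < tau by rewrite divr_gt0.
have tau1 : tau <= 1 by rewrite ler_pdivrMr // mul1r.
have tau_q n : (n <= N)%N -> tau <= 2 * q ^+ n.
  move=> nN; rewrite ler_wpM2l //.
  apply: (@le_trans _ _ (qnode q G N)); last first.
    apply: le_trans (qnode_leX G q_gt0 q_lt1 N) _.
    by apply: ler_wiXn2l => //; exact: ltW.
  rewrite -[leRHS]invrK lef_pV2 ?posrE ?invr_gt0 ?qnode_gt0 //.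
  by rewrite lerDr ltW ?qnode_gt0.
have kE : (N - i0 = k)%N by rewrite /= subKn.
have bad : \sum_(om : {ffun 'I_N -> 'I_K} * {ffun 'I_N -> 'I_K} | om.2 i0 != P0)
   qweight q G lam om <= 16 * c^-1 * (tau * A ^+ k) *
      \sum_(om : {ffun 'I_N -> 'I_K} * {ffun 'I_N -> 'I_K}) qweight q G lam om.
  rewrite -kE; apply: (@conf_weight_bad R (fun n => (jpoly R G n).[qcoord q G N]) (jweight R G)
    (fun n => entry_denom G (qnode q G n)) (qcoord q G) (fun n => 1 - q ^+ n) tau A c
    _ _ _ _ _ _ _ _ _ _ _ _ _ _ _ _ _ _ N K (shifted lam) _ i0 P0 P1) => //.
  - by move=> n; apply: jpoly_gt0.
  - by move=> n; apply: jpoly_ratio.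
  - exact: jweight_gt0.
  - exact: jweight_ratio.
  - by move=> n; apply: entry_denom_gt0.
  - by move=> n; apply: entry_denom_incr.
  - move=> n; apply: le_trans (A1P n) _; apply: ler_wpM2r; first exact/ltW/entry_denom_gt0.
    by rewrite ler_peMr // (le_trans ler01).
  - by move=> n; apply: qcoord_incr.
  - move=> m n mn; apply: le_trans (qcoord_ratio G q_gt0 q_lt1 mn) _.
    apply: ler_wpM2r; first by rewrite subr_ge0; apply: qcoord_le => //; exact: ltnW.
    by rewrite ler_peMl // (le_trans ler01).
  - by move=> n n_gt0; rewrite subr_gt0 exprn_ilt1 ?(ltW q_gt0) // -lt0n.
  - by move=> n; rewrite gerBl exprn_ge0 // ltW.
  - by move=> m n mn; rewrite lerB //; apply: ler_wiXn2l => //; exact: ltW.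
  - by move=> m p p'; apply: qcoord_beta.
  - by move=> n; apply: prod_1Bq_ge.
  - by move=> i iN; apply: shifted_dec.
  - rewrite kE; apply: (@le_trans _ _ (2 * q ^+ n0 * A ^+ k)).
      by rewrite ler_wpM2r ?tau_q // ltW.
    move: n0P; rewrite ler_pdivlMr ?mulr_gt0 // => n0P.
    by have -> : 2 * q ^+ n0 * A ^+ k = q ^+ n0 * (2 * A ^+ k) by ring.
apply: (@le_trans _ _ (\sum_(om : {ffun 'I_N -> 'I_K} * {ffun 'I_N -> 'I_K} | om.2 i0 != P0)
   branch_law q G lam om)).
  rewrite big_mkcond [leRHS]big_mkcond; apply: ler_sum => om _ /=.
  case: ifP => om_bad; last by case: ifP => // _; rewrite /branch_law divr_ge0 ?W0 ?(ltW Z0).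
  case: ifPn => // /negPn/eqP omP; rewrite /branch_law.
  suff -> : qweight q G lam om = 0 by rewrite mul0r.
  rewrite /qweight /conf_weight; case itl: (interlace_top (shifted lam) om.1 && interlace_low om.1 om.2) => //.
  have := unshift_sigK (fun a b => interlace_low_decr itl (i := a) (j := b)) i0.
  rewrite omP /= /shifted => shE; move: om_bad.
  have -> : (N.+1 - k = (N - k).+1)%N by rewrite subSn.
  have -> : (N.+2 - k = (N - k).+2)%N by rewrite !subSn // ltnW.
  by move=> /eqP; case; move: shE; rewrite subSS => /addIn.
rewrite /branch_law -mulr_suml ler_pdivrMr //; apply: le_trans bad _.
rewrite ler_wpM2r ?(ltW Z0) //.
have -> : 32 / c * A ^+ k * q ^+ N = 16 / c * ((2 * q ^+ N) * A ^+ k) by ring.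
by rewrite ler_wpM2l ?mulr_ge0 ?invr_ge0 ?(ltW c0) // ler_wpM2r ?tau_q // ltW.
Qed.
End OneStep.

(** * From one step to the boundary measures *)

Section Chain.
Variables (R : realType) (q : R) (G : series_type) (k : nat) (C : R) (N0 : nat).
Hypothesis q_gt0 : 0 < q.
Hypothesis q_lt1 : q < 1.
Hypothesis C_ge0 : 0 <= C.
Hypothesis step : forall N (lam : GT N.+1), (N0 <= N)%N ->
  exists (I : finType) (w : I -> R) (u : I -> GT N),
    is_image_law (Lambda1 q G lam) w u /\
    \sum_(i | part (u i) (N.+1 - k) != part lam (N.+2 - k)) w i <= C * q ^+ N.

Lemma Lambda_push (L d : nat) (l : GT (d.+1 + L)) (s : seq (GT L))
    (I : finType) (w : I -> R) (u : I -> GT (d + L)) :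
  is_image_law (@Lambda1 R q G (d + L) l) w u ->
  \sum_(m <- s) Lambda q G l m = \sum_i w i * \sum_(m <- s) Lambda q G (u i) m.
Proof.
move=> [_ _ lE].
under [RHS]eq_bigr do rewrite mulr_sumr.
rewrite exchange_big; apply: eq_bigr => m _ /=.
by rewrite lE (fsbig_image_law u w (fun n => @Lambda R q G L d n m)).2.
Qed.

Lemma Lambda_ge0 (L d : nat) (l : GT (d + L)) (m : GT L) :
  (N0 <= L)%N -> 0 <= Lambda q G l m.
Proof.
move=> NL; elim: d l => [|d IH] l; first by rewrite /= ler0n.
have [I [w [u [law _]]]] := step l (leq_trans NL (leq_addl d L)).
have [w0 _ _] := law; have := Lambda_push [:: m] law.
by rewrite big_seq1 => ->; apply: sumr_ge0 => i _; rewrite big_seq1 mulr_ge0.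
Qed.

Lemma Lambda_le1 (L d : nat) (l : GT (d + L)) (s : seq (GT L)) :
  (N0 <= L)%N -> uniq s -> \sum_(m <- s) Lambda q G l m <= 1.
Proof.
move=> NL us; elim: d l => [|d IH] l /=.
  case: (boolP ((l : GT L) \in s)) => ls; last first.
    rewrite big_seq big1 // => m ms; case: eqP => // lm.
    by move: ls; rewrite lm ms.
  rewrite (big_rem (l : GT L)) //= eqxx big_seq big1 ?addr0 // => m.
  by rewrite mem_rem_uniq // inE => /andP[/negPf]; rewrite eq_sym => ->.
have [I [w [u [law _]]]] := step l (leq_trans NL (leq_addl d L)).
have [w0 w1 _] := law.
rewrite (Lambda_push s law) -w1; apply: ler_sum => i _.
by rewrite -[leRHS]mulr1 ler_wpM2l.
Qed.

(** Union bound over the d steps of the chain. Finite sets of target signatures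
    are enough to pass to the limit later. *)
Lemma Lambda_drift_le (L d : nat) (l : GT (d + L)) (s : seq (GT L)) :
  (N0 <= L)%N -> uniq s ->
  (forall m, m \in s -> part m (L.+1 - k) != part l ((d + L).+1 - k)) ->
  \sum_(m <- s) Lambda q G l m <= \sum_(j < d) C * q ^+ (j + L).
Proof.
move=> NL us; elim: d l => [|d IH] l ls /=.
  rewrite big_ord0 big_seq big1 // => m ms; case: eqP => // lm.
  by have := ls m ms; rewrite lm eqxx.
have [I [w [u [law wb]]]] := step l (leq_trans NL (leq_addl d L)).
have [w0 w1 _] := law.
rewrite (Lambda_push s law) big_ord_recr /=.
set B := \sum_(j < d) _; have B0 : 0 <= B.
  by apply: sumr_ge0 => j _; rewrite mulr_ge0 // exprn_ge0 // ltW.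
apply: le_trans (lerD (lexx B) wb).
have -> : B = \sum_i w i * B by rewrite -mulr_suml w1 mul1r.
rewrite [X in _ + X]big_mkcond -big_split /=; apply: ler_sum => i _.
case: eqP => [ui|_] /=.
  by rewrite addr0 ler_wpM2l //; apply: IH => m ms; rewrite ui; exact: ls.
apply: (@le_trans _ _ (w i)); last by rewrite lerDr mulr_ge0.
by rewrite ler_piMr // Lambda_le1.
Qed.

Lemma geo_tail (L d : nat) :
  \sum_(j < d) C * q ^+ (j + L) <= C / (1 - q) * q ^+ L.
Proof.
have q1 : 0 < 1 - q by rewrite subr_gt0.
rewrite -mulr_sumr -mulrA ler_wpM2l // [leRHS]mulrC ler_pdivlMr //.
suff -> : (\sum_(j < d) q ^+ (j + L)) * (1 - q) = q ^+ L - q ^+ (d + L).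
  by rewrite gerBl exprn_ge0 // ltW.
elim: d => [|d IH]; first by rewrite big_ord0 mul0r subrr.
by rewrite big_ord_recr mulrDl IH /= addSn exprS; ring.
Qed.
End Chain.

Section Boundary.
Variables (y : nat -> nat).
Hypothesis hy : in_Y y.

Lemma sig_of_Y_sorted N : sorted geq [tuple y (N - i) | i < N].
Proof.
apply/(sortedP 0%N) => i; rewrite size_tuple => iN.
have -> : nth 0%N [tuple y (N - i)%N | i < N] i.+1 = y (N - i.+1)%N.
  by rewrite -[i.+1]/(nat_of_ord (Ordinal iN)) -tnth_nth tnth_mktuple.
have -> : nth 0%N [tuple y (N - i)%N | i < N] i = y (N - i)%N.
  by rewrite -[in LHS]/(nat_of_ord (Ordinal (ltnW iN))) -tnth_nth tnth_mktuple.
by apply: hy; [rewrite subn_gt0 | rewrite leq_sub2l].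
Qed.

(** The signature with lowest parts y_1, ..., y_N: a stabilizing sequence that
    attains its limits as soon as the parts exist. *)
Definition sig_of_Y N : GT N := exist _ [tuple y (N - i) | i < N] (sig_of_Y_sorted N).

Lemma part_sig_of_Y N i : (0 < i <= N)%N -> part (sig_of_Y N) (N.+1 - i) = y i.
Proof.
move=> /andP[i0 iN]; have jN : (N - i < N)%N by lia.
rewrite /part subSn //.
have := tnth_nth 0%N [tuple y (N - i)%N | i < N] (Ordinal jN).
by rewrite tnth_mktuple /= subKn // => ->.
Qed.

Lemma sig_of_Y_stabilizes : stabilizes sig_of_Y y.
Proof.
move=> i i0; apply: cvg_near_cst; exists i => // N /= iN.
by rewrite part_sig_of_Y // i0.
Qed.
End Boundary.

(** Signatures are countable, so a set is an increasing union of finite sets. *)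
Lemma GT_measure_le_finite (R : realType) (N : nat) (mu : probability (GT N) R)
    (B : set (GT N)) (e : R) :
  (forall s : seq (GT N), uniq s -> (forall m, m \in s -> B m) ->
     (\sum_(m <- s) mu [set m] <= e%:E)%E) ->
  (mu B <= e%:E)%E.
Proof.
move=> le_e.
pose F n := B `&` [set m : GT N | (choice.pickle (val m : N.-tuple nat) < n)%N].
have finF n : finite_set (F n).
  apply: (sub_finite_set (B := [set m : GT N | (choice.pickle (val m : N.-tuple nat) < n)%N])).
    by move=> m [].
  apply: (@finite_preimage _ _ `I_n (fun m : GT N => choice.pickle (val m : N.-tuple nat)));
    last exact: finite_II.
  by move=> m m' _ _ /(pcan_inj choice.pickleK)/val_inj.
have BF : B = \bigcup_n F n.
  apply/seteqP; split => [m Bm|m [n _ [] //]].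
  by exists (choice.pickle (val m : N.-tuple nat)).+1 => //; split => //=.
have muF n : (mu (F n) <= e%:E)%E.
  have -> : mu (F n) = (\sum_(m <- fset_set (F n)) mu [set m])%E.
    have {1}-> : F n = \bigcup_(m in F n) [set m] by rewrite bigcup_imset1 image_id.
    rewrite measure_fin_bigcup //; first by rewrite fsbig_finite.
    by move=> i j _ _ [m [/= -> ->]].
  apply: le_e; first exact: fset_uniq.
  by move=> m; rewrite in_fset_set // inE => -[].
have : mu \o F @ \oo --> mu B.
  rewrite BF; apply: nondecreasing_cvg_mu => //.
  move=> n n' nn; apply/subsetPset => m [Bm mn]; split => //.
  exact: leq_trans mn nn.
by move=> /cvge_to_le; apply; apply: nearW.
Qed.

Theorem theorem6p4 (R : realType) (q : R) (hq0 : 0 < q) (hq1 : q < 1)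
  (G : series_type) (y : nat -> nat) (hy : in_Y y)
  (M : forall N : nat, probability (GT N) R)
  (hM : forall N : nat, (0 < N)%N -> is_boundary_measure q G y (M N))
  (d : nat -> measure_display) (T : forall N : nat, measurableType (d N))
  (P : forall N : nat, probability (T N) R)
  (mu : forall N : nat, {RV (P N) >-> GT N})
  (hmu : forall N : nat, (0 < N)%N ->
     forall A : set (GT N), distribution (P N) (mu N) A = M N A)
  (k : nat) (hk : (0 < k)%N) :
  P L [set w | part (mu L w) (L.+1 - k) = y k] @[L --> \oo] --> 1%E.
Proof.
have [C [N0 [C0 step]]] := one_step_stability G hq0 hq1 hk.
pose e L : R := C / (1 - q) * q ^+ L.
have bound L : (maxn N0 k <= L)%N ->
    ((1 - e L)%:E <= P L [set w | part (mu L w) (L.+1 - k) = y k])%E.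
  rewrite geq_max => /andP[NL kL].
  have L0 : (0 < L)%N by apply: leq_trans kL.
  pose good := [set m : GT L | part m (L.+1 - k) = y k].
  rewrite -[X in (_ <= X)%E]/(distribution (P L) (mu L) good) hmu //.
  (* It remains to bound the probability of the complement, first on finite
   sets, where it is a limit of probabilities of drifting along the chain. *)
  rewrite -(setCK good) probability_setC // EFinB leeB //.
  apply: GT_measure_le_finite => s us bad.
  have lim : (\sum_(m <- s) (Lambda q G (sig_of_Y hy (n + L)) m)%:E @[n --> \oo]
      --> \sum_(m <- s) M L [set m])%E.
    apply: cvg_nnesum => m _; last exact: (hM L L0 _ (sig_of_Y_stabilizes hy)).
    by apply: nearW => n; rewrite lee_fin (Lambda_ge0 step).
  apply: (cvge_to_le lim); apply: nearW => n; rewrite sumEFin lee_fin.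
  apply: le_trans (geo_tail hq0 hq1 C0 L n).
  apply: (Lambda_drift_le hq0 C0 step) => // m ms; apply/eqP => mb; apply: (bad m ms).
  rewrite /good /= mb part_sig_of_Y //.
  by rewrite hk (leq_trans kL) // leq_addl.
apply: (@squeeze_cvge _ _ _ _ (fun L => (1 - e L)%:E) _ (fun=> 1%E)).
- near=> L; rewrite probability_le1 ?andbT; last first.
    rewrite -[X in measurable X]setTI.
    exact: (measurable_funPT (mu L) measurableT
      [set m | part m (L.+1 - k) = y k]).
  apply: bound; near: L; exact: nbhs_infty_ge.
- apply: cvg_EFin; first by apply: nearW.
  rewrite -[X in _ --> X]subr0; apply: cvgB; first exact: cvg_cst.
  rewrite -[X in _ --> X](mulr0 (C / (1 - q))); apply: cvgM; first exact: cvg_cst.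
  by apply: cvg_expr; rewrite ger0_norm // ltW.
- exact: cvg_cst.
Unshelve. all: by end_near.
Qed.
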